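(* Let $\mathbf{u}=(u_1,\dots,u_m):\mathbb{R}_+\times\mathbb{R}^N\to\mathbb{R}^m$ be a locally Lipschitz function and let $\gamma$ be an admissible curve. Then, for every index $i\in\{1,\dots,m\}$, $$\frac{d}{dt}\,\mathbb{E}_i\big[u_{\omega(t)}(t,\gamma(t,\omega))\big]_{\big|_{t=s}}=\mathbb{E}_i\Big[-(B\mathbf{u})_{\omega(s)}(s,\gamma(s,\omega))+\frac{d}{dt}u_{\omega(s)}(t,\gamma(t,\omega))_{\big|_{t=s}}\Big]$$ for a.e. $s\in\mathbb{R}_+$.
   Context: $N,m\ge 1$ are integers and $\mathbb{R}_+=[0,+\infty)$. $B=(b_{ij})$ is a real $m\times m$ matrix with $b_{ij}\le 0$ for $j\ne i$ and $\sum_{j=1}^m b_{ij}=0$ for every $i$; $(B\mathbf{u}(t,x))_i=\sum_{j}b_{ij}u_j(t,x)$. Random frame: $\Omega$ is the space of right-continuous paths $\omega:\mathbb{R}_+\to\{1,\dots,m\}$ with left limits; $\mathcal{F}$ is the $\sigma$-algebra on $\Omega$ generated by the evaluation maps $\pi_t(\omega)=\omega(t)$, $t\ge 0$ (it is the Borel $\sigma$-algebra of the Skorohod topology), and $\mathcal{F}_t$ is the one generated by $\pi_s$, $0\le s\le t$. $\Omega_i=\{\omega:\omega(0)=i\}$. $\mathbb{P}$ is a probability measure on $(\Omega,\mathcal{F})$ under which $(\pi_t)_{t\ge 0}$ is a Markov chain with generator matrix $-B$, i.e. $\mathbb{P}(\omega(t_k)=i_k\mid\omega(t_1)=i_1,\dots,\omega(t_{k-1})=i_{k-1})=(e^{-B(t_k-t_{k-1})})_{i_{k-1}i_k}$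 for all $0\le t_1<\dots<t_k$ and all states $i_1,\dots,i_k$ (whenever the conditioning event has positive probability), with $\mathbb{P}(\Omega_i)>0$ for each $i$. $\mathbb{P}_i$ is $\mathbb{P}$ conditioned to $\Omega_i$ (the law of the chain started at $i$), and $\mathbb{E}_i$ is the expectation with respect to $\mathbb{P}_i$. Admissible curve: a random variable $\gamma:\Omega\to C(\mathbb{R}_+;\mathbb{R}^N)$ (continuous paths, topology of local uniform convergence), written $\gamma(t,\omega)$, such that (i) it is uniformly in $\omega$ locally absolutely continuous: for any bounded interval $I$ and $\varepsilon>0$ there is $\delta_\varepsilon>0$ such that $\sum_j(b_j-a_j)<\delta_\varepsilon$ implies $\sum_j|\gamma(b_j,\omega)-\gamma(a_j,\omega)|<\varepsilon$ for any finite family $\{(a_j,b_j)\}$ of pairwise disjoint intervals contained in $I$ and any $\omega\in\Omega$; (ii) it is nonanticipating: for any $t\ge 0$, $\omega_1\equiv\omega_2$ in $[0,t]$ implies $\gamma(\cdot,\omega_1)\equiv\gamma(\cdot,\omega_2)$ in $[0,t]$. *)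

(* Defs.v *)
From HB Require Import structures.
From mathcomp Require Import all_boot all_order all_algebra.
From mathcomp Require Import all_classical all_reals all_analysis.

Set Implicit Arguments.
Unset Strict Implicit.
Unset Printing Implicit Defensive.

Import Order.TTheory GRing.Theory Num.Theory.
Import numFieldNormedType.Exports.

Local Open Scope classical_set_scope.
Local Open Scope ring_scope.

(* The m and N of the mathematical text, both >= 1, are m.+1 and N.+1 here;
   the states 1, ..., m are the elements of 'I_m.+1. *)

(* Functions on [0, +oo[ are represented by functions on R, and every
   condition below only involves their values on Rplus. *)
Definition Rplus (R : realType) : set R := `[0, +oo[.
Arguments Rplus : clear implicits.

Section path_space.
Context {R : realType} {m : nat}.

(* A path on [0, +oo[ is identified with its extension by the constant w 0 on
   ]-oo, 0[, so that Leibniz equality of paths is equality on [0, +oo[.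
   The states carry the discrete topology. *)
Definition cadlag (w : R -> discrete_topology 'I_m.+1) : Prop :=
  [/\ forall t : R, 0 <= t -> w s @[s --> t^'+] --> w t,
      forall t : R, 0 < t ->
        exists j : discrete_topology 'I_m.+1, w s @[s --> t^'-] --> j &
      forall t : R, t < 0 -> w t = w 0].

Record skorokhod : Type := Path {
  skorokhod_fun :> R -> 'I_m.+1 ;
  skorokhod_cadlag : cadlag skorokhod_fun }.

Lemma cadlag_cst (i : 'I_m.+1) : cadlag (fun=> i).
Proof. by split=> // t _; [exact: cvg_cst | exists i; exact: cvg_cst]. Qed.

HB.instance Definition _ := gen_eqMixin skorokhod.
HB.instance Definition _ := gen_choiceMixin skorokhod.
HB.instance Definition _ := isPointed.Build skorokhod (Path (cadlag_cst ord0)).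

Definition cylinders : set (set skorokhod) :=
  [set A | exists (t : R) (J : set 'I_m.+1),
    0 <= t /\ A = [set w : skorokhod | J (w t)]].

HB.instance Definition _ :=
  Measurable.copy skorokhod (g_sigma_algebraType cylinders).

Definition start_at (i : 'I_m.+1) : set skorokhod := [set w | w 0 = i].

Lemma measurable_start_at (i : 'I_m.+1) : measurable (start_at i).
Proof. by apply: sub_sigma_algebra; exists 0, [set i]. Qed.

End path_space.
Arguments skorokhod : clear implicits.

(* Since start_at i will have positive probability, the second argument of
   mnormalize (the value for a null measure) plays no role. *)
Definition start_law (R : realType) (m : nat)
    (P : probability (skorokhod R m) R)
    (i : 'I_m.+1) : probability (skorokhod R m) R :=
  mnormalize (mrestr P (measurable_start_at i)) P.

Definition expmx (R : realType) (n : nat) (A : 'M[R]_n.+1) : 'M[R]_n.+1 :=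
  limn (series (fun k => (k`!%:R : R)^-1 *: A ^+ k)).

Definition cond_prob d (T : measurableType d) (R : realType)
    (P : probability T R) (A C : set T) : R :=
  fine (P (A `&` C)) / fine (P C).

(* The times t 0 < ... < t k are those of the conditioning event, t k.+1 is
   the next one; the values of t and st beyond k.+1 are irrelevant. *)
Definition markov_chain (R : realType) (m : nat) (G : 'M[R]_m.+1)
    (P : probability (skorokhod R m) R) : Prop :=
  forall (k : nat) (t : nat -> R) (st : nat -> 'I_m.+1),
    0 <= t 0%N -> (forall j, (j <= k)%N -> t j < t j.+1) ->
    let past :=
      [set w : skorokhod R m | forall j, (j <= k)%N -> w (t j) = st j] in
    (0 < P past)%E ->
    cond_prob P [set w : skorokhod R m | w (t k.+1) = st k.+1] past
    = expmx ((t k.+1 - t k) *: G) (st k) (st k.+1).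

Section admissible_curves.
Context {R : realType} {m N : nat}.
Implicit Type gamma : skorokhod R m -> R -> 'rV[R]_N.+1.

(* The topology of uniform convergence on the compact subsets of [0, +oo[;
   on C([0, +oo[; R^N) it induces that of local uniform convergence, so the
   last condition is Borel measurability. *)
Definition random_curve gamma : Prop :=
  (forall w, {within Rplus R, continuous (gamma w)}) /\
  (forall U : set {family compactly_in (Rplus R), R -> 'rV[R]_N.+1},
     open U -> measurable [set w | U (gamma w)]).

Definition uniformly_locally_AC gamma : Prop :=
  forall I : set R, I `<=` Rplus R -> is_interval I -> bounded_set I ->
  forall e : R, 0 < e -> exists2 d : R, 0 < d &
  forall (n : nat) (a b : 'I_n -> R),
    (forall j, a j < b j) ->
    (forall j, `]a j, b j[ `<=` I) ->
    trivIset [set: 'I_n] (fun j => `]a j, b j[%classic) ->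
    \sum_j (b j - a j) < d ->
  forall w, \sum_j `|gamma w (b j) - gamma w (a j)| < e.

Definition nonanticipating gamma : Prop :=
  forall t, 0 <= t -> forall w1 w2 : skorokhod R m,
    {in `[0, t], w1 =1 w2} -> {in `[0, t], gamma w1 =1 gamma w2}.

Definition admissible gamma : Prop :=
  [/\ random_curve gamma, uniformly_locally_AC gamma & nonanticipating gamma].

End admissible_curves.

(* Main.v *)
Require Import Defs.
From HB Require Import structures.
From mathcomp Require Import all_boot all_order all_algebra.
From mathcomp Require Import all_classical all_reals all_analysis.
From mathcomp Require Import measurable_realfun ring lra.

Set Implicit Arguments.
Unset Strict Implicit.
Unset Printing Implicit Defensive.

Import Order.TTheory GRing.Theory Num.Theory.
Import numFieldNormedType.Exports.

Local Open Scope classical_set_scope.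
Local Open Scope ring_scope.

(* Fix T > 0, let f_k(t, w) be u_k(t, gamma(t, w)) for 0 <= t <= T, frozen
   outside [0, T], and let F(t) be the expectation of f_{w(t)}(t, w). The f_k are
   bounded and absolutely continuous, uniformly in w, and f_k(t, .) depends only
   on the path up to time t.

   On a uniform mesh of step h, F(t_{c+1}) - F(t_c) is the sum of
   E[f_{w(t_{c+1})}(t_{c+1}, w) - f_{w(t_{c+1})}(t_c, w)], the integral over the
   cell of the derivative of f in the state frozen at the right end point, and of
   E[f_{w(t_{c+1})}(t_c, w) - f_{w(t_c)}(t_c, w)], which is
   h E[-(B f)_{w(t_c)}(t_c, w)] + O(h^2) by the Markov property and the
   first-order expansion of exp(-hB). Paths are right-continuous, so the state at
   the right end points converging to r is eventually w(r), and dominated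
   convergence gives
   F(t) - F(0) = E[int_0^t Psi(r, w) dr],
   Psi(r, w) = -(B f)_{w(r)}(r, w) + f_{w(r)}'(r, w).
   Fubini and Lebesgue differentiation yield F' = E[Psi] almost everywhere. The
   set of (t, w) at which some f_k(., w) is not differentiable is measurable with
   null sections at fixed w, hence null sections at almost every fixed t. *)

(** * Absolutely continuous functions *)

(** The integrand of F jumps with the chain, so F cannot be differentiated path by path; the
    integral identity has to come first. In splitting an increment of F, the state is frozen at the
    right end point and the jump is evaluated with f at the left one. This order is forced: the
    Markov property at t_c applies to f(t_c, .), which does not look beyond t_c, while f(t_{c+1}, .)
    may depend on the jump itself. The price is that the pathwise Riemann sums carry the drift at
    right end points and the Markov estimate carries it at left ones; the mismatch telescopes to h
    times the difference of the expected drifts at t and at 0. A modulus of absolute continuity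
    common to all w bounds the integral of |f_k'(., w)| independently of w. This one bound dominates
    both the limit over meshes and the integrand in Fubini's theorem. *)

Section chains.
Context {R : realType}.
Implicit Types (h : R -> R) (s : seq (R * R)).

(* A chain is a finite family of non-overlapping intervals listed from left to
   right; unlike indexed families, chains can be concatenated and refined. *)
Fixpoint chain (lo : R) s : bool :=
  if s is p :: s' then (lo <= p.1 <= p.2) && chain p.2 s' else true.

Definition mesh s : R := \sum_(p <- s) (p.2 - p.1).

Definition jumps h s : R := \sum_(p <- s) `|h p.2 - h p.1|.

Definition abs_cont_modulus (h : R -> R) (e d : R) :=
  forall lo s, chain lo s -> mesh s < d -> jumps h s <= e.

Definition abs_cont h :=
  forall e : R, 0 < e -> exists2 d : R, 0 < d & abs_cont_modulus h e d.

Lemma chain_le lo lo' s : lo' <= lo -> chain lo s -> chain lo' s.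
Proof.
by case: s => //= p s l /andP[/andP[? ->] ->]; rewrite (le_trans l).
Qed.

Lemma chain_partition a t u : path <%R a t -> chain (last a t) u ->
  chain a (zip (a :: t) t ++ u).
Proof.
elim: t a => [//|b t ih] a /= /andP[ab bt] cu.
by rewrite lexx (ltW ab)/= ih.
Qed.

Lemma chain_pairwise lo s : chain lo s ->
  all (fun p => lo <= p.1 <= p.2) s /\ pairwise (fun p q : R * R => p.2 <= q.1) s.
Proof.
elim: s lo => // p s ih lo /= /andP[/andP[lp p12] /ih[ha hp]].
rewrite lp p12 hp ?andbT/= ?andbT; split; apply/allP => q /(allP ha)/andP[pq q12] //.
by rewrite q12 andbT (le_trans lp)// (le_trans p12).
Qed.

Lemma mesh_partition a t : mesh (zip (a :: t) t) = last a t - a.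
Proof.
elim: t a => [|b t ih] a /=; first by rewrite /mesh big_nil subrr.
by rewrite /mesh big_cons/= -/(mesh _) ih addrC subrKA.
Qed.

Lemma mesh_cons p s : mesh (p :: s) = p.2 - p.1 + mesh s.
Proof. exact: big_cons. Qed.

Lemma mesh_cat s t : mesh (s ++ t) = mesh s + mesh t.
Proof. exact: big_cat. Qed.

Lemma jumps_cat h s t : jumps h (s ++ t) = jumps h s + jumps h t.
Proof. exact: big_cat. Qed.

Lemma jumps_partition h a b t : itv_partition a b t ->
  jumps h (zip (a :: t) t) = variation a b h t.
Proof.
move=> abt; rewrite (variation_zip _ abt) /jumps.
elim: t a {abt} => [|c t ih] a /=; first by rewrite !big_nil.
by rewrite !big_cons/= ih.
Qed.

Lemma total_variation_le_modulus h e d a b :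
  abs_cont_modulus h e d -> a <= b -> b - a < d ->
  (total_variation a b h <= e%:E)%E.
Proof.
move=> he ab bad; apply: ge_ereal_sup => _ [_ [t abt <-] <-].
rewrite lee_fin -(jumps_partition _ abt).
case: abt => pt /eqP lt.
apply: (he a); last by rewrite mesh_partition lt.
by rewrite -[zip _ _]cats0 chain_partition.
Qed.

Lemma total_variation_le_pieces h e d a n : 0 <= d ->
  (forall x y, x <= y <= x + d -> (total_variation x y h <= e%:E)%E) ->
  (total_variation a (a + d *+ n) h <= (e *+ n)%:E)%E.
Proof.
move=> d0 hd; elim: n => [|n ih].
  by rewrite !mulr0n addr0 total_variationxx.
have an : a <= a + d *+ n by rewrite lerDl mulrn_wge0.
have nn : a + d *+ n <= a + d *+ n.+1 by rewrite lerD2l mulrS lerDr.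
rewrite (total_variationD h an nn) [e *+ _]mulrSr EFinD; apply: leeD => //.
by apply: hd; rewrite nn mulrSr addrA lexx.
Qed.

(** The interval is cut into pieces of length d/2, because the modulus asks for a mesh strictly
    below d. The bound involves only e, d and b - a, so it is common to all functions sharing a
    modulus. *)
Lemma abs_cont_modulus_total_variation h e d a b :
  abs_cont_modulus h e d -> 0 < d -> a <= b ->
  (total_variation a b h <= (e *+ (Num.bound ((b - a) / (d / 2))))%:E)%E.
Proof.
move=> he d0 ab; set n := Num.bound _.
have d20 : 0 < d / 2 by rewrite divr_gt0.
have bn : b <= a + d / 2 *+ n.
  rewrite -lerBlDl -mulr_natl -ler_pdivrMr//.
  by apply/ltW/archi_boundP; rewrite divr_ge0 ?subr_ge0// ltW.
apply: (@le_trans _ _ (total_variation a (a + d / 2 *+ n) h)).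
  by rewrite (total_variationD h ab bn) leeDl// total_variation_ge0.
apply: total_variation_le_pieces; first exact: ltW.
move=> x y /andP[xy yx]; apply: (total_variation_le_modulus he) => //; lra.
Qed.

Lemma abs_cont_total_variation_fin_num h a b : abs_cont h -> a <= b ->
  total_variation a b h \is a fin_num.
Proof.
move=> /(_ _ ltr01)[d d0 hd] ab.
rewrite ge0_fin_numE ?total_variation_ge0//.
exact: le_lt_trans (abs_cont_modulus_total_variation hd d0 ab) (ltry _).
Qed.

(** Invariance under [clamp T] expresses that a function is frozen outside [0, T]. As [clamp T] is
    nondecreasing and 1-Lipschitz, it maps chains to chains without increasing the mesh. *)
Definition clamp (T x : R) : R := Num.max 0 (Num.min x T).

Lemma clamp_ge0 T x : 0 <= clamp T x.
Proof. by rewrite /clamp le_max lexx. Qed.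

Lemma clamp_le T x : 0 <= T -> clamp T x <= T.
Proof. by move=> T0; rewrite /clamp ge_max T0 ge_min lexx orbT. Qed.

Lemma clamp_id T x : 0 <= x <= T -> clamp T x = x.
Proof. by move=> /andP[x0 xT]; rewrite /clamp (min_idPl xT) (max_idPr x0). Qed.

Lemma le_clamp T x y : x <= y -> clamp T x <= clamp T y.
Proof.
move=> xy; rewrite /clamp ge_max le_max lexx/= le_max; apply/orP; right.
by rewrite le_min ge_min xy/= ge_min lexx orbT.
Qed.

Lemma clampB_le T x y : 0 <= T -> x <= y -> clamp T y - clamp T x <= y - x.
Proof.
move=> T0 xy; rewrite /clamp; set x' := Num.min x T; set y' := Num.min y T.
have [xy' yx'] : x' <= y' /\ y' - x' <= y - x.
  by rewrite /x' /y'; case: (leP x T) => xT; case: (leP y T) => yT; split; lra.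
by case: (leP 0 x') => x0; case: (leP 0 y') => y0; lra.
Qed.

Definition clamp_pair (T : R) (p : R * R) := (clamp T p.1, clamp T p.2).

Lemma chain_clamp T lo s : chain lo s -> chain (clamp T lo) (map (clamp_pair T) s).
Proof.
elim: s lo => //= p s ih lo /andP[/andP[lp pp] ps].
by rewrite !le_clamp//= ih.
Qed.

Lemma mesh_clamp T lo s : 0 <= T -> chain lo s ->
  mesh (map (clamp_pair T) s) <= mesh s.
Proof.
move=> T0; elim: s lo => [|p s ih] lo /=; first by rewrite /mesh !big_nil.
move=> /andP[/andP[lp pp] ps]; rewrite /mesh !big_cons/= lerD//.
  exact: clampB_le.
exact: ih ps.
Qed.

(** A nearly optimal partition of each interval, all of them concatenated, is again a chain of the
    same mesh. A modulus for h thus controls sums of total variations. *)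
Lemma abs_cont_approx h lo s (e : R) :
  (forall a b, a <= b -> total_variation a b h \is a fin_num) ->
  chain lo s -> 0 < e -> exists s', [/\ chain lo s', mesh s' = mesh s &
   \sum_(p <- s) fine (total_variation p.1 p.2 h) <= jumps h s' + e *+ size s].
Proof.
move=> fintv; elim: s lo => [|[a b] s ih] lo /=.
  by exists [::]; rewrite /jumps !big_nil addr0; split.
move=> /andP[/andP[loa ab] bs] e0.
have [s' [cs' ms' js']] := ih _ bs e0.
have := fintv _ _ ab; move: (ab); rewrite le_eqVlt => /predU1P[abE|ltab] ftv.
  exists s'; split; first by apply: chain_le cs'; rewrite (le_trans loa).
    by rewrite mesh_cons/= abE subrr add0r -ms'.
  rewrite big_cons/= abE total_variationxx add0r (le_trans js')//.
  by rewrite lerD2l mulrS lerDr ltW.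
have [x] := @ub_ereal_sup_adherent _ _ _ e0 ftv.
move=> [_ [t abt <-] <-]; rewrite lt_def => /andP[_ tve].
have tve' : fine (total_variation a b h) <= variation a b h t + e.
  by rewrite -lee_fin fineK// EFinD -leeBlDr.
have [pt /eqP lt] := abt.
exists (zip (a :: t) t ++ s'); split.
- by apply: chain_le loa _; apply: chain_partition => //; rewrite lt.
- by rewrite mesh_cat mesh_partition lt ms' mesh_cons.
- rewrite big_cons/= jumps_cat (jumps_partition _ abt) mulrS addrACA.
  exact: lerD.
Qed.

End chains.

(** * Jordan decomposition of an absolutely continuous function *)

Section variation_function.
Context {R : realType}.
Variables (h : R -> R) (T : R).
Hypotheses (hT : forall x, h x = h (clamp T x)) (T0 : 0 <= T) (hac : abs_cont h).

Let V x := fine (total_variation 0 (clamp T x) h).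

Let VB a b : a <= b ->
  V b - V a = fine (total_variation (clamp T a) (clamp T b) h).
Proof.
move=> ab; have ca := le_clamp T ab; rewrite /V.
rewrite (total_variationD h (clamp_ge0 T a) ca) fineD.
- by rewrite addrC addKr.
- exact/abs_cont_total_variation_fin_num/clamp_ge0.
- exact: abs_cont_total_variation_fin_num.
Qed.

Let normrB_le_VB a b : a <= b -> `|h b - h a| <= V b - V a.
Proof.
move=> ab; rewrite (VB ab) [h b]hT [h a]hT -lee_fin.
by rewrite fineK ?total_variation_ge ?abs_cont_total_variation_fin_num// le_clamp.
Qed.

Let V_nd : {homo V : x y / x <= y}.
Proof.
move=> x y xy; rewrite -subr_ge0.
exact: le_trans (normr_ge0 _) (normrB_le_VB xy).
Qed.

Let V_ac : abs_cont V.
Proof.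
move=> e e0; have e20 : 0 < e / 2 by rewrite divr_gt0.
have [d d0 hd] := hac e20; exists d => // lo s cs sd.
(* One error eta is spent per interval of s, at most e/2 in all; the successor avoids a division by
   zero when s is empty. *)
set eta := (e / 2) / (size s).+1%:R.
have eta0 : 0 < eta by rewrite divr_gt0.
have [s' [cs' ms' js']] := abs_cont_approx
  (fun a b ab => abs_cont_total_variation_fin_num hac ab) (chain_clamp T cs) eta0.
have -> : jumps V s = \sum_(p <- map (clamp_pair T) s)
    fine (total_variation p.1 p.2 h).
  rewrite big_map /jumps; elim: s lo cs {sd eta eta0 js' ms' cs'} => [|p s ih] lo.
    by rewrite !big_nil.
  move=> /= /andP[/andP[_ pp] cs]; rewrite !big_cons (ih _ cs); congr (_ + _).
  by rewrite ger0_norm ?subr_ge0 ?V_nd// VB.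
apply: (le_trans js'); rewrite size_map (splitr e); apply: lerD.
  by apply: (hd _ _ cs'); rewrite ms'; exact: le_lt_trans (mesh_clamp T0 cs) sd.
by rewrite -[eta *+ _]mulr_natr /eta mulrAC ler_pdivrMr// ler_pM2l// ler_nat.
Qed.

(** The decomposition is h = V - (V - h), with V the variation function from 0. The last inequality
    will bound the L^1 norm of the density of h. *)
Lemma abs_cont_decomposition : exists V1 V2 : R -> R,
  [/\ {homo V1 : x y / x <= y} /\ {homo V2 : x y / x <= y},
      abs_cont V1 /\ abs_cont V2,
      (forall x, V1 x = V1 (clamp T x)) /\ (forall x, V2 x = V2 (clamp T x)),
      forall x, h x = V1 x - V2 x &
      V1 T - V1 0 + (V2 T - V2 0) <= 2 * fine (total_variation 0 T h) + `|h T - h 0|].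
Proof.
have cc x : clamp T (clamp T x) = clamp T x.
  by rewrite clamp_id// clamp_ge0 clamp_le.
exists V, (V \- h); split.
- split=> // x y xy /=; rewrite -subr_ge0.
  rewrite /= (_ : V y - h y - (V x - h x) = (V y - V x) - (h y - h x)); last by ring.
  by rewrite subr_ge0 (le_trans (ler_norm _))// normrB_le_VB.
- split=> //= e e0; have e20 : 0 < e / 2 by rewrite divr_gt0.
  have [d1 d10 hd1] := hac e20; have [d2 d20 hd2] := V_ac e20.
  exists (Num.min d1 d2); first by rewrite lt_min d10.
  move=> lo s cs; rewrite lt_min => /andP[sd1 sd2].
  apply: (@le_trans _ _ (jumps V s + jumps h s)).
    rewrite /jumps -big_split/=; apply: ler_sum => p _.
    rewrite /= (_ : V p.2 - h p.2 - (V p.1 - h p.1) =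
      (V p.2 - V p.1) - (h p.2 - h p.1)); last by ring.
    exact: ler_normB.
  by rewrite (splitr e) lerD// ?(hd1 _ _ cs)// (hd2 _ _ cs).
- by split => x /=; rewrite /V cc// [h x]hT.
- by move=> x /=; rewrite opprB addrC subrK.
- rewrite /= {1}/V {2}/V /V clamp_id ?lexx ?T0// clamp_id ?lexx ?T0//.
  rewrite total_variationxx /= !subr0 sub0r opprK.
  have := ler_norm (- (h T - h 0)); rewrite normrN; lra.
Qed.

End variation_function.

(* The Stieltjes measure of a nondecreasing absolutely continuous function is
   dominated by Lebesgue measure, so its Radon-Nikodym density is the derivative. *)
Section stieltjes.
Context {R : realType}.
Notation mu := (@lebesgue_measure R).
Variables (G : R -> R) (T : R).
Hypotheses (GT : forall x, G x = G (clamp T x)) (T0 : 0 <= T).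
Hypotheses (Gnd : {homo G : x y / x <= y}) (Gac : abs_cont G).

Let G_rc : right_continuous G.
Proof.
move=> x; apply/cvgrPdist_le => e e0.
have [d d0 hd] := Gac e0; near=> y.
have xy : x <= y by near: y; exact: nbhs_right_ge.
have := hd x [:: (x, y)]; rewrite /= lexx xy /mesh /jumps !big_seq1/= distrC.
by apply => //; rewrite ltrBlDl; near: y; apply: nbhs_right_lt; rewrite ltrDl.
Unshelve. all: by end_near. Qed.

Let Gc : cumulative R R := HB.pack G (isCumulative.Build R _ R G Gnd G_rc).

Let nu := lebesgue_stieltjes_measure Gc.

Let nu_itv a b : a <= b -> nu `]a, b]%classic = (G b - G a)%:E.
Proof.
move=> ab; rewrite /nu /lebesgue_stieltjes_measure /measure_extension.
by rewrite measurable_mu_extE/=; [rewrite wlength_itv_bnd|exact: is_ocitv].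
Qed.

(** Since G is frozen outside [0, T], the intervals ]-n, n] exhausting the line all have mass at
    most G T - G 0. *)
Let nuT : (nu setT <= (G T - G 0)%:E)%E.
Proof.
rewrite -(bigcup_itvT false false).
pose I n : set R := `]- (n%:R), n%:R]%classic.
have : nu (I n) @[n --> \oo] --> nu (\bigcup_n I n).
  apply: nondecreasing_cvg_mu; rewrite /I//; first exact: bigcup_measurable.
  by move=> *; apply/subsetPset/subset_itv; rewrite leBSide/= ?lerN2 ler_nat.
move=> /cvg_lim <-//; apply: lime_le.
  apply: ereal_nondecreasing_is_cvgn => m n mn; apply: le_measure.
  - by rewrite inE; exact: measurable_itv.
  - by rewrite inE; exact: measurable_itv.
  - by apply/subset_itv; rewrite leBSide/= ?lerN2 ler_nat.
near=> n; rewrite nu_itv ?ge0_cp// lee_fin [G n%:R]GT [G (- _)]GT.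
by apply: lerB; apply: Gnd; rewrite ?clamp_le ?clamp_ge0.
Unshelve. all: by end_near. Qed.

Let cells (x : nat -> R) (P : pred nat) k M :=
  [seq (x i, x i.+1) | i <- iota k M & P i].

Let chain_cells x P k M : {homo x : m n / (m <= n)%N >-> m <= n} ->
  chain (x k) (cells x P k M).
Proof.
move=> xnd; rewrite /cells; elim: M k => //= M ih k.
case: ifPn => _ /=; first by rewrite lexx xnd//= ih.
by apply: chain_le (ih _); exact: xnd.
Qed.

Let sum_cells x P M (F : R * R -> R) :
  \sum_(p <- cells x P 0 M) F p = \sum_(i < M | P i) F (x i, x i.+1).
Proof.
rewrite big_map big_filter -(big_mkord P (fun i => F (x i, x i.+1))).
by rewrite /index_iota subn0.
Qed.

(* [O n] collects the grid cells contained in U; [C n] turns the sequence into an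
   increasing one whose union is still U. *)
Let cells_cover (A U : set R) (d e : R) : measurable A -> open U -> A `<=` U ->
  (mu U < d%:E)%E -> abs_cont_modulus G e d -> (nu A <= e%:E)%E.
Proof.
move=> mA oU AU mUd Gde.
pose x n i : R := - n.+1%:R + i%:R / n.+1%:R.
pose P n i := `[< `]x n i, x n i.+1]%classic `<=` U >].
(* The grid of step 1/(n+1) starting at -(n+1) reaches n+1 after this many cells. *)
pose M n := (n.+1 * (2 * n.+1))%N.
pose O n := \big[setU/set0]_(i < M n | P n i) `]x n i, x n i.+1]%classic.
have xnd n : {homo x n : i j / (i <= j)%N >-> i <= j}.
  by move=> i j ij; rewrite /x lerD2l ler_pM2r ?ler_nat// invr_gt0.
have mO n : measurable (O n) by apply: bigsetU_measurable.
have OU n : O n `<=` U.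
  by apply: (big_ind (fun X => X `<=` U)) => //[X Y XU YU|i /asboolP//]; rewrite subUset.
have tO n : trivIset setT (fun i : 'I_(M n) => `]x n i, x n i.+1]%classic).
  apply/trivIsetP => i j _ _; wlog : i j / (i < j)%N.
    move=> wl ij; have := ij; rewrite -val_eqE neq_ltn => /orP[]; first by move/wl; exact.
    by move/wl; rewrite setIC; apply; rewrite eq_sym.
  move=> ij _; apply/seteqP; split => // z [] /=; rewrite !in_itv/=.
  move=> /andP[_ zi] /andP[jz _].
  by have := lt_le_trans jz (le_trans zi (xnd n _ _ ij)); rewrite ltxx.
have nuO n : (nu (O n) <= e%:E)%E.
  have -> : nu (O n) = (jumps G (cells (x n) (P n) 0 (M n)))%:E.
    transitivity (\sum_(i < M n | P n i) nu `]x n i, x n i.+1]%classic)%E.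
      exact: (@measure_bigsetU_ord _ _ _ nu (M n) (fun i => P n i)
        (fun i : 'I_(M n) => `]x n i, x n i.+1]%classic)).
    rewrite /jumps sum_cells -sumEFin; apply: eq_bigr => i _.
    by rewrite nu_itv ?xnd// ger0_norm ?subr_ge0 ?Gnd ?xnd.
  rewrite lee_fin; apply: Gde; first exact: chain_cells (xnd n).
  rewrite -lte_fin; apply: le_lt_trans mUd.
  have <- : mu (O n) = (mesh (cells (x n) (P n) 0 (M n)))%:E.
    transitivity (\sum_(i < M n | P n i) mu `]x n i, x n i.+1]%classic)%E.
      exact: (@measure_bigsetU_ord _ _ _ mu (M n) (fun i => P n i)
        (fun i : 'I_(M n) => `]x n i, x n i.+1]%classic)).
    rewrite /mesh sum_cells -sumEFin; apply: eq_bigr => i _.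
    rewrite lebesgue_measure_itv/= lte_fin; case: ltP => //.
    move=> xx; congr (_%:E); apply/eqP; rewrite eq_le subr_le0 subr_ge0 xx.
    by rewrite xnd.
  by apply: le_measure; rewrite ?inE; [exact: mO|exact: open_measurable|exact: OU].
pose C n := \bigcap_(k in [set k | (n <= k)%N]) O k.
have mC n : measurable (C n) by apply: bigcap_measurable; [exists n => /=|move=> k _; exact: mO].
have nuC n : (nu (C n) <= e%:E)%E.
  apply: le_trans (nuO n); apply: le_measure; rewrite ?inE;
    [exact: mC|exact: mO|by move=> z Cz; exact: (Cz n (leqnn n))].
have cvgC : nu (C n) @[n --> \oo] --> nu (\bigcup_n C n).
  apply: nondecreasing_cvg_mu.
  - exact: mC.
  - by apply: bigcup_measurable => k _; exact: mC.
  move=> m n mn; apply/subsetPset => z Cz k /= nk; apply: Cz => /=.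
  exact: leq_trans nk.
apply: (@le_trans _ _ (nu (\bigcup_n C n))); last first.
  rewrite -(cvg_lim _ cvgC)//; apply: lime_le; first by apply/cvg_ex; eexists; exact: cvgC.
  by apply: nearW.
apply: le_measure; rewrite ?inE; [exact: mA|by apply: bigcup_measurable => k _; exact: mC|].
move=> z /AU Uz; have /nbhs_ballP[r /= r0 zrU] : nbhs z U by exact: open_nbhs_nbhs.
pose N := maxn (Num.bound `|z|) (Num.bound r^-1).
exists N => // n /= Nn.
have zn : `|z| < n.+1%:R.
  apply: (lt_le_trans (archi_boundP (normr_ge0 z))); rewrite ler_nat.
  by rewrite (leq_trans _ (leqW Nn))// leq_maxl.
have rn : n.+1%:R^-1 < r.
  rewrite invf_plt ?posrE//.
  apply: (lt_le_trans (archi_boundP _)); first by rewrite invr_ge0 ltW.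
  by rewrite ler_nat (leq_trans _ (leqW Nn))// leq_maxr.
have n0 : (n.+1%:R : R) != 0 by rewrite pnatr_eq0.
have xM : z <= x n (M n).
  have -> : x n (M n) = n.+1%:R by rewrite /x /M !natrM; field.
  by rewrite ltW// (le_lt_trans (ler_norm z)).
have ex : exists i, z <= x n i by exists (M n).
case: (ex_minnP ex) => -[|i] zi minI.
  exfalso; move: zi; rewrite /x mul0r addr0 leNgt => /negP; apply.
  by rewrite ltrNl (le_lt_trans (ler_norm _))// normrN.
have xz : x n i < z by rewrite ltNge; apply/negP => /minI; rewrite ltnn.
have iM : (i < M n)%N by exact: minI.
have xx : x n i.+1 = x n i + n.+1%:R^-1 by rewrite /x -[i.+1]addn1 natrD mulrDl mul1r addrA.
have Pi : P n i.
  apply/asboolP => y /=; rewrite in_itv/= => /andP[yi iy]; apply: zrU.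
  rewrite /ball/= ltr_norml; rewrite xx in zi iy.
  move: (_^-1) rn zi iy => q rn zi iy; apply/andP; split; lra.
by rewrite /O (bigD1 (Ordinal iM))//=; left; rewrite /= in_itv/= xz.
Qed.

Let nu_dom : nu `<< mu.
Proof.
apply/null_content_dominatesP => A mA A0; apply/eqP.
rewrite eq_le measure_ge0 andbT; apply/lee_addgt0Pr => e e0; rewrite add0e.
have [d d0 hd] := Gac e0.
have [|U [oU AU UA]] := @lebesgue_regularity_outer R A d mA _ d0.
  by rewrite A0.
apply: (cells_cover mA oU AU _ hd).
apply: le_lt_trans UA.
rewrite -[leRHS]adde0 -[in leRHS]A0 -measureU//.
- by rewrite setUC setDUK.
- by apply: measurableD => //; exact: open_measurable.
- by apply/seteqP; split => // z [[]].
Qed.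

Let nufin : fin_num_fun nu.
Proof.
move=> A mA; rewrite ge0_fin_numE//; apply: le_lt_trans (ltry (G T - G 0)).
apply: le_trans nuT; apply: le_measure; rewrite ?inE; [exact: mA|exact: measurableT|].
exact: subsetT.
Qed.

Let nuf : {finite_measure set (measurableTypeR R) -> \bar R} :=
  HB.pack (lebesgue_stieltjes_measure Gc) (Measure_isFinite.Build _ _ _ nu nufin).

Lemma nondecreasing_abs_cont_integral : exists g : R -> R,
  [/\ forall x, 0 <= g x,
      mu.-integrable setT (EFin \o g),
      (\int[mu]_x (g x)%:E <= (G T - G 0)%:E)%E &
      forall a b, a <= b -> (\int[mu]_(x in `]a, b]) (g x)%:E = (G b - G a)%:E)%E].
Proof.
have [g [g0 gfin gint gE]] := @radon_nikodym_sigma_finite _ _ _ mu nuf nu_dom.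
have gK : EFin \o (fine \o g) = g by apply/funext => x /=; rewrite fineK.
exists (fine \o g); split.
- by move=> x; exact: fine_ge0.
- by rewrite gK.
- have -> : (\int[mu]_x ((fine \o g) x)%:E = \int[mu]_x g x)%E.
    by apply: eq_integral => x _; rewrite -[in RHS]gK.
  by rewrite -gE.
- move=> a b ab; rewrite -nu_itv//.
  have -> : (\int[mu]_(x in `]a, b]) ((fine \o g) x)%:E = \int[mu]_(x in `]a, b]) g x)%E.
    by apply: eq_integral => x _; rewrite -[in RHS]gK.
  by rewrite -gE.
Qed.

End stieltjes.

(** * Fundamental theorem of calculus for absolutely continuous functions *)

Section abs_cont_ftc.
Context {R : realType}.
Notation mu := (@lebesgue_measure R).

(** The density is the difference of the two Radon-Nikodym densities of the Jordan parts. The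
    derivative is identified for x > 0 only, because the antiderivative is taken from 0 and equals h
    - h 0 to the right of 0. *)
Lemma abs_cont_integral (h : R -> R) (T : R) :
  (forall x, h x = h (clamp T x)) -> 0 <= T -> abs_cont h ->
  exists g : R -> R,
  [/\ mu.-integrable setT (EFin \o g),
      (\int[mu]_x `|g x|%:E <=
        (2 * fine (total_variation 0 T h) + `|h T - h 0|)%:E)%E,
      forall a b, a <= b -> \int[mu]_(x in `]a, b]) g x = h b - h a &
      {ae mu, forall x, 0 < x -> derivable h x 1 /\ derive1 h x = g x}].
Proof.
move=> hT T0 hac.
have [V1 [V2 [[V1nd V2nd] [V1ac V2ac] [V1T V2T] hV Vle]]] :=
  abs_cont_decomposition hT T0 hac.
have [g1 [g10 g1int g1le g1E]] := nondecreasing_abs_cont_integral V1T T0 V1nd V1ac.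
have [g2 [g20 g2int g2le g2E]] := nondecreasing_abs_cont_integral V2T T0 V2nd V2ac.
have gint : mu.-integrable setT (EFin \o (g1 \- g2)).
  exact: (integrableB measurableT g1int g2int).
have gE a b : a <= b -> \int[mu]_(x in `]a, b]) (g1 x - g2 x) = h b - h a.
  move=> ab; rewrite RintegralB//; try exact: integrableS g1int; try exact: integrableS g2int.
  by rewrite /Rintegral g1E// g2E//= !hV; ring.
exists (g1 \- g2); split => //.
- apply: (@le_trans _ _ (\int[mu]_x ((g1 x)%:E + (g2 x)%:E))%E).
    apply: ge0_le_integral => //.
    + apply/measurable_EFinP/measurableT_comp => //.
      by have /integrableP[/measurable_EFinP] := gint.
    + apply: emeasurable_funD; first by have /integrableP[] := g1int.
      by have /integrableP[] := g2int.
    + move=> x _; rewrite -EFinD lee_fin (le_trans (ler_normB _ _))//.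
      by rewrite !ger0_norm.
  rewrite ge0_integralD//; [|by move=> x _; rewrite lee_fin| |by move=> x _; rewrite lee_fin|].
  + by apply: (le_trans (leeD g1le g2le)); rewrite -EFinD lee_fin.
  + by have /integrableP[] := g1int.
  + by have /integrableP[] := g2int.
- have gloc := open_integrable_locally openT gint.
  have gloc0 y : mu.-integrable [set` Interval (BRight 0) (BRight y)] (EFin \o (g1 \- g2)).
    exact: integrableS gint.
  have := FTC1 gloc0 gloc.
  apply: filterS; first exact: (ae_filter_ringOfSetsType mu).
  move=> x H x0; have [dF F'] := H x0.
  pose F (y : R) : R := \int[mu]_(t in `]0, y]) (g1 \- g2) t.
  have near_F : \forall y \near x, (F \+ cst (h 0)) y = h y.
    near=> y; rewrite /F /= gE; first by rewrite subrK.
    by apply: ltW; near: y; exact: lt_nbhsr.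
  have dFx : is_derive x 1 F ((g1 \- g2) x).
    by move: F'; rewrite derive1E => F'; exact: (DeriveDef dF F').
  have dFhx : is_derive x 1 (F \+ cst (h 0)) ((g1 \- g2) x).
    by rewrite -[(g1 \- g2) x]addr0; apply: is_deriveD.
  have hx := near_eq_is_derive near_F dFhx.
  by rewrite derive1E; split; [exact: ex_derive|exact: derive_val].
Unshelve. all: by end_near. Qed.

End abs_cont_ftc.

(** * Joint measurability of functions and derivatives *)

Section joint_measurability.
Context d (Om : measurableType d) (R : realType).
Implicit Types f : R -> Om -> R.

(** The right end point of the z-th cell of step 1/(n+1). It lies strictly to the right of the
    points of its cell, as the filter [t^'+] excludes t. *)
Let dyad (n : nat) (z : int) : R := (z + 1)%:~R / n.+1%:R.

Let cell (n : nat) (t : R) : int := Num.floor (t * n.+1%:R).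

Let dyad_cvg t : dyad n (cell n t) @[n --> \oo] --> t^'+.
Proof.
have lt_dyad n : t < dyad n (cell n t).
  by rewrite /dyad ltr_pdivlMr// floorD1_gt.
move=> U /= [e /= e0 eU]; exists (Num.bound e^-1) => // n /= en.
apply: eU (lt_dyad n); rewrite /ball/= distrC ger0_norm ?subr_ge0 ?(ltW (lt_dyad n))//.
rewrite ltrBlDr /dyad rmorphD/= mulrDl mul1r addrC; apply: ltr_leD.
  rewrite invf_plt ?posrE//; apply: (lt_le_trans (archi_boundP _)).
    by rewrite invr_ge0 ltW.
  by rewrite ler_nat (leq_trans en).
by rewrite ler_pdivrMr// floor_le.
Qed.

(** Replacing the time by the next grid point leaves countably many times, for which measurability
    in w suffices; right continuity makes f the pointwise limit of these approximants. *)
Lemma measurable_fun_right_continuous f :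
  (forall t, measurable_fun setT (f t)) ->
  (forall w t, f s w @[s --> t^'+] --> f t w) ->
  measurable_fun setT (fun x : R * Om => f x.1 x.2).
Proof.
move=> mf fc; apply: (measurable_fun_cvg (h :=
  fun n (x : R * Om) => f (dyad n (cell n x.1)) x.2)) => [n|x _]; last first.
  exact: (cvg_trans (cvg_app (fun s => f s x.2) (dyad_cvg (t := x.1))) (fc x.2 x.1)).
move=> _ Y mY; rewrite setTI.
rewrite [X in measurable X](_ : _ = \bigcup_(z : int)
  ([set t | cell n t = z] `*` (f (dyad n z) @^-1` Y))); last first.
  apply/seteqP; split => [[t w] /= Yf|[t w] [z _] [/= <-]//].
  by exists (cell n t).
apply: countable_bigcupT_measurable => [|z]; first exact: countableP.
apply: measurableX; last by rewrite -[X in measurable X]setTI; exact: mf.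
rewrite [X in measurable X](_ : _ = `[z%:~R / n.+1%:R, dyad n z[%classic).
  exact: measurable_itv.
apply/seteqP; split => t /=; rewrite in_itv/= /dyad ler_pdivrMr// ltr_pdivlMr//.
  by move=> <-; exact: floor_itv.
by move=> zt; apply/eqP; rewrite /cell floor_eq.
Qed.

Lemma measurable_fun_continuous f :
  (forall t, measurable_fun setT (f t)) -> (forall w, continuous (f^~ w)) ->
  measurable_fun setT (fun x : R * Om => f x.1 x.2).
Proof.
move=> mf fc; apply: measurable_fun_right_continuous => // w.
exact: (right_continuousW (fc w)).
Qed.

Definition diff_quotient (g : R -> R) (t h : R) : R := h^-1 *: (g (h + t) - g t).

Lemma derivable_diff_quotient (g : R -> R) t :
  derivable g t 1 = cvg (diff_quotient g t @ 0^').
Proof.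
rewrite /derivable; suff -> : (fun h => h^-1 *: ((g \o shift t) (h *: 1) - g t)) =
  diff_quotient g t by [].
by apply/funext => h; rewrite /diff_quotient /= [h *: 1]mulr1.
Qed.

(* Restricting the increments to rationals makes differentiability of a
   continuous function a countable condition. *)
Definition rat_cauchy (g : R -> R) t := forall p : nat, exists n : nat,
  forall a b : rat, 0 < `|ratr a : R| < n.+1%:R^-1 -> 0 < `|ratr b : R| < n.+1%:R^-1 ->
  `|diff_quotient g t (ratr a) - diff_quotient g t (ratr b)| <= p.+1%:R^-1.

Let inv_lt (e : R) : 0 < e -> exists n : nat, n.+1%:R^-1 < e.
Proof.
move=> e0; exists (Num.bound e^-1); rewrite invf_plt ?posrE//.
apply: (lt_le_trans (archi_boundP _)); first by rewrite invr_ge0 ltW.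
by rewrite ler_nat.
Qed.

Lemma derivable_rat_cauchyP (g : R -> R) t : continuous g ->
  derivable g t 1 <-> rat_cauchy g t.
Proof.
move=> gc; rewrite derivable_diff_quotient -cauchy_cvgP -cauchy_ballP; split.
  move=> qc p; have p0 : 0 < (p.+1%:R : R)^-1 by rewrite invr_gt0.
  have [[A B] /= [A0 B0] AB] := qc _ p0.
  have [r /= r0 rAB] : (diff_quotient g t @ (0:R)^') (A `&` B)
    by exact: filterI.
  have [n nr] := inv_lt r0.
  have nrAB (a : R) : 0 < `|a| < n.+1%:R^-1 ->
      A (diff_quotient g t a) /\ B (diff_quotient g t a).
    move=> /andP[a0 an]; apply: rAB; last by rewrite -normr_gt0.
    by rewrite /ball/= sub0r normrN (lt_trans an).
  exists n => a b /nrAB[Aa _] /nrAB[_ Bb].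
  by have := AB (_, _) (conj Aa Bb); rewrite /ball/= => /ltW.
move=> qc e e0; have [p pe] := inv_lt e0; have [n nq] := qc p.
have approx (a eta : R) : 0 < `|a| < n.+1%:R^-1 -> 0 < eta ->
    exists2 q : rat, 0 < `|ratr q : R| < n.+1%:R^-1 &
      `|diff_quotient g t a - diff_quotient g t (ratr q)| < eta.
  move=> /andP[a0 an] eta0.
  have qa : {for a, continuous (diff_quotient g t)}.
    apply: (@continuousZ R R^o _ (fun h : R => h^-1) (fun h => g (h + t) - g t)).
      by apply: inv_continuous; rewrite -normr_gt0.
    apply: continuousB; last exact: cst_continuous.
    apply: (@continuous_comp _ _ _ (fun h => h + t) g); last exact: gc.
    by apply: continuousD => //; exact: cst_continuous.
  have na : `|h| @[h --> a] --> `|a| by exact: norm_continuous.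
  have [r /= r0 ra] : nbhs a [set h | (0 < `|h| < n.+1%:R^-1) /\
      `|diff_quotient g t a - diff_quotient g t h| < eta].
    near=> h; split; last by near: h; move/cvgrPdist_lt : qa; exact.
    by apply/andP; split; near: h; [move/cvgr_gt : na|move/cvgr_lt : na]; exact.
  have [q] : exists q, ratr q \in `]a - r, a + r[.
    by apply: rat_in_itvoo; rewrite ltrBlDr -addrA ltrDl addr_gt0.
  rewrite in_itv/= => /andP[aq qa'].
  have [|q1 q2] := ra (ratr q); last by exists q.
  by rewrite /ball/= ltr_norml; apply/andP; split; lra.
have real_cauchy (a b : R) : 0 < `|a| < n.+1%:R^-1 -> 0 < `|b| < n.+1%:R^-1 ->
    `|diff_quotient g t a - diff_quotient g t b| < e.
  (* The gap between the rational bound 1/(p+1) and e is shared by the two approximations of real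
     increments by rational ones. *)
  move=> an bn; pose eta := (e - p.+1%:R^-1) / 2.
  have eta0 : 0 < eta by rewrite divr_gt0// subr_gt0.
  have [qa qan aqa] := approx _ _ an eta0; have [qb qbn bqb] := approx _ _ bn eta0.
  have := nq _ _ qan qbn; move: pe aqa bqb; rewrite /eta !ltr_norml ler_norml.
  move: (diff_quotient _ _ _) (diff_quotient _ _ _) (diff_quotient _ _ _).
  move=> x y z; move: (diff_quotient _ _ _) (_^-1) => u c pe.
  by move=> /andP[? ?] /andP[? ?] /andP[? ?]; apply/andP; split; lra.
have n0 : \forall h \near (0:R)^', 0 < `|h| < (n.+1%:R^-1 : R).
  exists (n.+1%:R^-1) => /= [|h]; first by rewrite invr_gt0.
  by rewrite /ball/= sub0r normrN normr_gt0 => -> ->.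
pose S := diff_quotient g t @` [set h : R | 0 < `|h| < n.+1%:R^-1].
exists (S, S); first by split; apply: filterS n0 => h hn; exists h.
by move=> [_ _] /= [[a an <-] [b bn <-]]; rewrite /ball/=; exact: real_cauchy.
Unshelve. all: by end_near. Qed.

Section derivative.
Variable f : R -> Om -> R.
Hypotheses (mf : forall t, measurable_fun setT (f t))
  (fc : forall w, continuous (f^~ w)).

Let measurable_diff_quotient h :
  measurable_fun setT (fun x : R * Om => diff_quotient (f^~ x.2) x.1 h).
Proof.
apply: measurable_funM; first exact: measurable_cst.
apply: measurable_funB; last exact: measurable_fun_continuous.
apply: (@measurable_fun_continuous (fun t => f (h + t))) => // w x.
apply: (@continuous_comp _ _ _ (fun t => h + t) (f^~ w)); last exact: fc.
by apply: continuousD; [exact: cst_continuous|exact: cvg_id].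
Qed.

Lemma measurable_derivable :
  measurable [set x : R * Om | derivable (f^~ x.2) x.1 1].
Proof.
pose A (p n : nat) (ab : rat * rat) := [set x : R * Om |
  0 < `|ratr ab.1 : R| < n.+1%:R^-1 -> 0 < `|ratr ab.2 : R| < n.+1%:R^-1 ->
  `|diff_quotient (f^~ x.2) x.1 (ratr ab.1) -
    diff_quotient (f^~ x.2) x.1 (ratr ab.2)| <= p.+1%:R^-1].
have -> : [set x : R * Om | derivable (f^~ x.2) x.1 1] =
    \bigcap_p \bigcup_n (~` (\bigcup_ab ~` A p n ab)).
  apply/seteqP; split => x /=.
    move=> /(derivable_rat_cauchyP _ (@fc x.2)) cx p _; have [n nx] := cx p.
    exists n => //; move=> [[a b] _ nA]; apply: nA => a0 b0; exact: nx.
  move=> Ax; apply/(derivable_rat_cauchyP _ (@fc x.2)) => p.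
  have [n _ nx] := Ax p I; exists n => a b a0 b0; apply: contrapT => nab.
  by apply: nx; exists (a, b) => //= nx; apply: nab; exact: nx.
apply: bigcapT_measurable => p; apply: bigcupT_measurable => n; apply: measurableC.
apply: countable_bigcupT_measurable => [|[a b]]; first exact: countableP.
apply: measurableC; rewrite /A /=.
have [a0|a0] := boolP (0 < `|ratr a : R| < n.+1%:R^-1); last first.
  by rewrite [X in measurable X](_ : _ = setT)//; apply/seteqP; split.
have [b0|b0] := boolP (0 < `|ratr b : R| < n.+1%:R^-1); last first.
  by rewrite [X in measurable X](_ : _ = setT)//; apply/seteqP; split.
rewrite [X in measurable X](_ : _ = setT `&` (fun x : R * Om =>
  `|diff_quotient (f^~ x.2) x.1 (ratr a) - diff_quotient (f^~ x.2) x.1 (ratr b)|)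
  @^-1` `]-oo, p.+1%:R^-1]); last first.
  rewrite setTI; apply/seteqP; split => x /=; rewrite in_itv/=; first by apply.
  by move=> + _ _.
apply: measurableT_comp; [exact: normr_measurable|exact: measurable_funB|exact: measurableT|].
exact: measurable_itv.
Qed.

Lemma measurable_derive1 :
  measurable_fun setT (fun x : R * Om => derive1 (f^~ x.2) x.1).
Proof.
(* Off D, [derive1] is the limit of a divergent filter, whose default value is [point]; the
   approximants below take that same value there. *)
pose D := [set x : R * Om | derivable (f^~ x.2) x.1 1].
apply: (measurable_fun_cvg (h := fun n x => if `[< D x >]
  then diff_quotient (f^~ x.2) x.1 n.+1%:R^-1 else point)) => [n|x _].
  apply: measurable_fun_ifT => //; apply: (measurable_fun_bool true).
  rewrite setTI (_ : _ @^-1` _ = D); first exact: measurable_derivable.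
  by apply/seteqP; split => x /=; [move/asboolP|move=> ?; exact/asboolP].
case: asboolP => [|nDx]; last first.
  rewrite /derive1 dvgP; first exact: cvg_cst.
  by move=> cx; apply: nDx; rewrite /D/= derivable_diff_quotient.
rewrite /D/= derivable_diff_quotient => cx.
have hn : (fun n : nat => n.+1%:R^-1 : R) @ \oo --> (0:R)^'.
  move=> U /= [e /= e0 eU]; have [n ne] := inv_lt e0.
  exists n => // k /= nk; apply: eU; last by rewrite invr_eq0 pnatr_eq0.
  rewrite /ball/= sub0r normrN ger0_norm ?invr_ge0//; apply: le_lt_trans ne.
  by rewrite lef_pV2 ?posrE// ler_nat.
exact: (cvg_trans (cvg_app (diff_quotient (f^~ x.2) x.1) hn) cx).
Qed.

End derivative.

End joint_measurability.

(** * Markov chains on path space *)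

Section path_space.
Context {R : realType} {m : nat}.
Local Notation path := (skorokhod R m).

Lemma measurable_at (t : R) (J : set 'I_m.+1) : measurable [set w : path | J (w t)].
Proof.
have [t0|t0] := leP 0 t; first by apply: sub_sigma_algebra; exists t, J.
have -> : [set w : path | J (w t)] = [set w : path | J (w 0)].
  by apply/seteqP; split=> w /=; have [_ _ /(_ t t0) ->] := skorokhod_cadlag w.
by apply: sub_sigma_algebra; exists 0, J.
Qed.

Lemma path_right_cst (w : path) (t : R) : \forall s \near t^'+, w s = w t.
Proof.
have [rc _ cst] := skorokhod_cadlag w.
have [t0|t0] := leP 0 t; first by apply: (rc t t0 [set w t]).
near=> s; rewrite (cst _ t0) cst//; near: s; exact: nbhs_right_lt.
Unshelve. all: by end_near. Qed.

(* Dependence on the path up to time a only is expressed as invariance under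
   [stop]. *)
Section stop.
Variables (a : R) (a0 : 0 <= a).

Lemma cadlag_stop (w : path) : cadlag (fun t => w (Num.min t a)).
Proof.
have [rc ll cst] := skorokhod_cadlag w; split.
- move=> t t0; have [ta|ta] := ltP t a.
    move=> U wU; apply: filterS2 (nbhs_right_lt ta) (rc t t0 U wU) => s sa.
    by rewrite /= (min_idPl (ltW sa)).
  move=> U wU; apply: filterS (nbhs_right_ge t) => s ts /=.
  by rewrite (min_idPr (le_trans ta ts)); exact: nbhs_singleton wU.
- move=> t t0; have [ta|ta] := leP t a.
    have [j wj] := ll t t0; exists j => U jU.
    apply: filterS2 (nbhs_left_le t) (wj U jU) => s st.
    by rewrite /= (min_idPl (le_trans st ta)).
  exists (w a) => U wU; apply: filterS (nbhs_left_ge ta) => s ts /=.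
  by rewrite (min_idPr ts); exact: nbhs_singleton wU.
- by move=> t t0; rewrite (min_idPl (ltW (lt_le_trans t0 a0))) (min_idPl a0) cst.
Qed.

Definition stop (w : path) : path := Path (cadlag_stop w).

Lemma stopE w t : stop w t = w (Num.min t a). Proof. by []. Qed.

Lemma stop_eq w : {in `[0, a], stop w =1 w}.
Proof. by move=> t; rewrite stopE in_itv/= => /andP[_ ta]; rewrite (min_idPl ta). Qed.

Lemma measurable_stop : measurable_fun setT stop.
Proof.
apply: (measurability (@cylinders R m)) => // _ [_ [t [J [t0 ->]]] <-].
by rewrite setTI; apply: measurable_at.
Qed.

End stop.

(* Allowing inconsistent prescriptions makes the family of these events closed
   under intersection, by concatenation of the lists. *)
Definition fdim_event (l : seq (R * 'I_m.+1)) : set path :=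
  [set w | forall p, p \in l -> w p.1 = p.2].

Definition fdim_events : set (set path) :=
  [set A | exists2 l, A = fdim_event l & forall p, p \in l -> 0 <= p.1].

Lemma fdim_event_cons p l :
  fdim_event (p :: l) = [set w : path | w p.1 = p.2] `&` fdim_event l.
Proof.
apply/seteqP; split => w.
  move=> H; split; first by apply: H; rewrite inE eqxx.
  by move=> q ql; apply: H; rewrite inE ql orbT.
by move=> [H1 H2] q; rewrite inE => /predU1P[->//|]; exact: H2.
Qed.

Lemma fdim_event_cat l1 l2 :
  fdim_event (l1 ++ l2) = fdim_event l1 `&` fdim_event l2.
Proof.
elim: l1 => [|p l ih] /=.
  by apply/seteqP; split => w; [split|case].
by rewrite !fdim_event_cons ih setIA.
Qed.

Lemma measurable_fdim_event l : measurable (fdim_event l).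
Proof.
elim: l => [|p l ih].
  by rewrite (_ : fdim_event _ = setT)//; apply/seteqP; split.
rewrite fdim_event_cons; apply: measurableI => //.
exact: (measurable_at p.1 [set p.2]).
Qed.

Lemma stop_fdim_event a (a0 : 0 <= a) l :
  stop a0 @^-1` fdim_event l = fdim_event [seq (Num.min p.1 a, p.2) | p <- l].
Proof.
apply/seteqP; split => w /= H.
  by move=> _ /mapP[p pl ->] /=; rewrite -H.
by move=> p pl; have := H (Num.min p.1 a, p.2); apply; apply/mapP; exists p.
Qed.

(** Uniqueness of measures on a pi-system: the events are stable under intersection, the empty list
    gives the whole space, and each generating cylinder is a finite union of them since there are
    finitely many states. *)
Lemma eq_measure_fdim (m1 m2 : {measure set path -> \bar R}) :
  (m1 setT < +oo)%E ->
  (forall l, (forall p, p \in l -> 0 <= p.1) -> m1 (fdim_event l) = m2 (fdim_event l)) ->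
  forall A, measurable A -> m1 A = m2 A.
Proof.
move=> m1T m12 A mA.
have fT : fdim_events setT by exists [::] => //; apply/seteqP; split.
apply: (g_sigma_algebra_measure_unique fdim_events _ (fun=> setT)) => //.
- by move=> _ [l -> _]; exact: measurable_fdim_event.
- by apply/seteqP; split => // w _; exists 0%N.
- move=> _ _ [l1 -> l10] [l2 -> l20]; exists (l1 ++ l2).
    by rewrite fdim_event_cat.
  by move=> p; rewrite mem_cat => /orP[/l10|/l20].
- by move=> _ [l -> l0]; exact: m12.
apply: smallest_sub mA; first exact: smallest_sigma_algebra.
move=> _ [t [J [t0 ->]]].
rewrite (_ : [set w : path | J (w t)] =
  \bigcup_(j in J) [set w : path | w t = j]); last first.
  by apply/seteqP; split => [w Jw|w [j Jj /= ->]//]; exists (w t).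
apply: (@fin_bigcup_measurable _ (g_sigma_algebraType fdim_events)).
  exact: finite_finset.
move=> j _; apply: sub_sigma_algebra; exists [:: (t, j)].
  apply/seteqP; split => w /= wj; last exact: (wj (t, j) (mem_head _ _)).
  by move=> p; rewrite inE => /eqP ->.
by move=> p; rewrite inE => /eqP ->.
Qed.

End path_space.

Lemma integral_mrestr d (T : measurableType d) (R : realType)
    (mu : {measure set T -> \bar R}) (D : set T) (mD : measurable D) (f : T -> \bar R) :
  measurable_fun setT f ->
  (\int[mrestr mu mD]_x f x = \int[mu]_(x in D) f x)%E.
Proof.
move=> mf.
have mfS A : measurable A -> measurable_fun A f by move=> mA; exact: measurable_funS mf.
rewrite -(setUv D) integral_setU//; last 3 first.
- exact: measurableC.
- by rewrite setUv.
- by apply/disj_setPS; rewrite setICr.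
rewrite [X in (_ + X)%E]null_set_integral ?adde0//.
- by apply: eq_measure_integral => A mA AD; rewrite /= /mrestr setIidl.
- exact: measurableC.
- exact/mfS/measurableC.
- by rewrite /= /mrestr setICl measure0.
Qed.

Section markov.
Context {R : realType} {m : nat}.
Local Notation path := (skorokhod R m).
Variables (G : 'M[R]_m.+1) (P : probability path R).
Hypothesis P_markov : markov_chain G P.

(** The Markov hypothesis wants strictly increasing times with one state each, whereas l may be
    unordered, redundant or contradictory. If the event has positive mass it contains a path [w0];
    the times are then sorted without repetition, and the states are read off [w0]. *)
Lemma markov_fdim (a b : R) (k j : 'I_m.+1) l : 0 <= a -> a < b ->
  (forall p, p \in l -> 0 <= p.1 <= a) ->
  (P ([set w : path | w b = j] `&` fdim_event ((a, k) :: l)) =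
   (expmx ((b - a) *: G) k j)%:E * P (fdim_event ((a, k) :: l)))%E.
Proof.
move=> a0 ab la; set E := fdim_event _.
have mE : measurable E by exact: measurable_fdim_event.
have mb : measurable [set w : path | w b = j] by exact: (measurable_at b [set j]).
have mEb : measurable ([set w : path | w b = j] `&` E) by exact: measurableI.
have [PE0|PE0] := eqVneq (P E) 0%E.
  rewrite PE0 mule0; apply/eqP; rewrite eq_le measure_ge0 andbT -PE0.
  by apply: le_measure; rewrite ?inE//; apply: subIsetr.
have [w0 w0E] : E !=set0.
  by apply/set0P/eqP => E0; move: PE0; rewrite E0 measure0 eqxx.
have w0a : w0 a = k by exact: (w0E (a, k) (mem_head _ _)).
pose s := sort <=%R (undup [seq p.1 | p <- l & p.1 < a]).
pose K := size s.
(* The times of l below a, then a at index K, then b at index K+1; prescriptions at time a itself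
   are merged with (a, k). *)
pose t := nth b (rcons (rcons s a) b).
pose st r := if r == K.+1 then j else w0 (t r).
have sa r : r \in s -> 0 <= r < a.
  rewrite mem_sort mem_undup => /mapP[p]; rewrite mem_filter => /andP[pa pl] ->.
  by rewrite pa andbT; have /andP[] := la _ pl.
have tK : t K = a by rewrite /t nth_rcons size_rcons ltnSn nth_rcons ltnn eqxx.
have tK1 : t K.+1 = b by rewrite /t nth_rcons size_rcons ltnn eqxx.
have ts r : (r < K)%N -> t r \in s.
  move=> rK; rewrite /t nth_rcons size_rcons ltnS (ltnW rK) nth_rcons rK.
  exact: mem_nth.
have t0 : 0 <= t 0%N.
  case: (posnP K) => [K0|/ts /sa /andP[]//].
  by rewrite -K0 tK.
have t_lt r : (r <= K)%N -> t r < t r.+1.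
  have : sorted <%R (rcons (rcons s a) b).
    rewrite (sorted_pairwise lt_trans) -!cats1 !pairwise_cat/= !allrel1r !andbT.
    rewrite -(sorted_pairwise lt_trans) sort_lt_sorted undup_uniq ?all_cat/= ?ab ?andbT.
    by apply/andP; split; apply/allP => r' /sa /andP[_ ra] //=; exact: lt_trans ra ab.
  move=> /(sortedP b)/(_ r); rewrite !size_rcons => H rK.
  exact: H.
have pastE : [set w : path | forall r, (r <= K)%N -> w (t r) = st r] = E.
  apply/seteqP; split => w /= H.
    move=> p; rewrite inE => /predU1P[->/=|pl].
      by have := H K (leqnn K); rewrite tK /st ltn_eqF// tK w0a.
    have -> : p.2 = w0 p.1 by rewrite w0E// inE pl orbT.
    have /andP[p0 pa] := la _ pl; move: pa; rewrite le_eqVlt => /predU1P[->|pa].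
      by have := H K (leqnn K); rewrite tK /st ltn_eqF// tK.
    have ps : p.1 \in s.
      by rewrite mem_sort mem_undup; apply/mapP; exists p => //; rewrite mem_filter pa.
    have iK : (index p.1 s < K)%N by rewrite index_mem.
    have tp : t (index p.1 s) = p.1.
      by rewrite /t nth_rcons size_rcons ltnS (ltnW iK) nth_rcons iK nth_index.
    by have := H _ (ltnW iK); rewrite /st ltn_eqF ?(ltn_trans iK)// tp.
  move=> r rK; rewrite /st ltn_eqF//.
  move: rK; rewrite leq_eqVlt => /predU1P[->|rK].
    by rewrite tK w0a; exact: (H (a, k) (mem_head _ _)).
  have := ts _ rK; rewrite mem_sort mem_undup => /mapP[p].
  rewrite mem_filter => /andP[_ pl] ->.
  have pl' : p \in (a, k) :: l by rewrite inE pl orbT.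
  by rewrite (H _ pl') (w0E _ pl').
have := P_markov t0 t_lt; move=> /(_ st) /=; rewrite pastE.
have PE : (0 < P E)%E by rewrite lt0e PE0 measure_ge0.
move=> /(_ PE); rewrite tK tK1 /st eqxx ltn_eqF// tK w0a => <-.
rewrite /cond_prob -[in RHS](@fineK _ (P E)) ?fin_num_measure//.
rewrite -EFinM divfK ?fineK ?fin_num_measure//.
by rewrite fine_eq0 ?fin_num_measure.
Qed.

Variable i : 'I_m.+1.
Hypothesis P_start : (0 < P (start_at i))%E.

Let Pi := start_law P i.

Lemma start_lawE A : measurable A ->
  Pi A = (P (A `&` start_at i) * (fine (P (start_at i)))^-1%:E)%E.
Proof.
move=> mA; rewrite /Pi /start_law /= /mnormalize /= /mrestr setTI.
rewrite gt_eqF//= lt_eqF//.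
by rewrite (le_lt_trans (probability_le1 _ (measurable_start_at i))) ?ltry.
Qed.

(** Starting at i is one more prescription (0, i) in the past, so the Markov property of P applies
    and the normalising constant passes through. *)
Lemma start_law_markov_fdim (a b : R) (k j : 'I_m.+1) l : 0 <= a -> a < b ->
  (forall p, p \in l -> 0 <= p.1 <= a) ->
  (Pi ([set w : path | w b = j] `&` fdim_event ((a, k) :: l)) =
   (expmx ((b - a) *: G) k j)%:E * Pi (fdim_event ((a, k) :: l)))%E.
Proof.
move=> a0 ab la.
have mb : measurable [set w : path | w b = j] by exact: (measurable_at b [set j]).
have mE : measurable (fdim_event ((a, k) :: l) : set path) by exact: measurable_fdim_event.
have startE (l' : seq (R * 'I_m.+1)) :
    (fdim_event ((a, k) :: l') : set path) `&` start_at i =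
    fdim_event ((a, k) :: (0, i) :: l').
  rewrite !fdim_event_cons -setIA; congr (_ `&` _); rewrite setIC; congr (_ `&` _).
rewrite !start_lawE//; last exact: measurableI.
rewrite -setIA startE markov_fdim ?muleA// => p.
by rewrite inE => /predU1P[->|/la//]; rewrite lexx.
Qed.

(* The transition probability as a quotient of masses: it is nonnegative even
   when the state k is never visited at time a. *)
Lemma start_law_markov (a b : R) (a0 : 0 <= a) (k j : 'I_m.+1) A :
  a < b -> measurable A ->
  (Pi ([set w : path | w a = k] `&` [set w | w b = j] `&` stop a0 @^-1` A) =
   (fine (Pi ([set w : path | w a = k] `&` [set w | w b = j])) /
    fine (Pi [set w : path | w a = k]))%:E *
   Pi ([set w : path | w a = k] `&` stop a0 @^-1` A))%E.
Proof.
move=> ab mA.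
pose D2 := [set w : path | w a = k]; pose D1 := D2 `&` [set w : path | w b = j].
have mD2 : measurable D2 by exact: (measurable_at a [set k]).
have mD1 : measurable D1 by apply: measurableI => //; exact: (measurable_at b [set j]).
rewrite -/D2 -/D1; set q := fine _ / _.
have q0 : 0 <= q by rewrite divr_ge0// fine_ge0.
have mS : measurable_fun setT (stop a0 : path -> path) := measurable_stop a0.
rewrite setIC [D2 `&` _]setIC.
(* Both sides are measures in A, images under [stop] of restrictions of [Pi], so they need only be
   compared on the finite-dimensional events. *)
apply: (@eq_measure_fdim R m (pushforward (mrestr Pi mD1) (stop a0))
  (mscale (NngNum q0) (pushforward (mrestr Pi mD2) (stop a0)))) => //.
  change (Pi (setT `&` D1) < +oo)%E.
  by rewrite (le_lt_trans (probability_le1 _ _)) ?ltry// setTI.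
move=> l l0.
change (Pi (stop a0 @^-1` fdim_event l `&` D1) =
  q%:E * Pi (stop a0 @^-1` fdim_event l `&` D2))%E.
rewrite stop_fdim_event; set l' := map _ _.
have l'a p : p \in l' -> 0 <= p.1 <= a.
  by move=> /mapP[q' /l0 q0' ->]/=; rewrite le_min q0' a0 ge_min lexx orbT.
have -> : fdim_event l' `&` D1 = [set w : path | w b = j] `&` fdim_event ((a, k) :: l').
  by apply/seteqP; rewrite fdim_event_cons /D1 /D2; split => w /=; tauto.
have -> : fdim_event l' `&` D2 = fdim_event ((a, k) :: l').
  by rewrite fdim_event_cons setIC.
rewrite start_law_markov_fdim//.
have D1E : D1 = [set w : path | w b = j] `&` fdim_event [:: (a, k)].
  rewrite fdim_event_cons (_ : fdim_event [::] = setT) ?setIT; first by rewrite setIC.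
  by apply/seteqP; split.
have D2E : D2 = fdim_event [:: (a, k)].
  rewrite fdim_event_cons (_ : fdim_event [::] = setT) ?setIT//.
  by apply/seteqP; split.
(* When k has mass zero at time a, q is not a transition probability, but the masses it relates
   vanish. *)
have [D20|D20] := eqVneq (Pi D2) 0%E.
  have -> : Pi (fdim_event ((a, k) :: l')) = 0%E.
    apply/eqP; rewrite eq_le measure_ge0 andbT -D20; apply: le_measure; rewrite ?inE//.
      exact: measurable_fdim_event.
    by rewrite fdim_event_cons; apply: subIsetl.
  by rewrite !mule0.
congr (_%:E * _)%E; rewrite /q D1E start_law_markov_fdim// -D2E.
rewrite fineM ?fin_num_measure//= mulfK// fine_eq0//.
exact: fin_num_measure.
Qed.

End markov.

(** * First-order expansion of the matrix exponential *)

Section matrix_exponential.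
Context {R : realType} {n : nat}.
Implicit Types A L : 'M[R]_n.+1.

Lemma cvg_mx_entrywise (s : nat -> 'M[R]_n.+1) L :
  (forall i j, s k i j @[k --> \oo] --> L i j) -> s k @[k --> \oo] --> L.
Proof.
move=> sL; apply/cvg_ballP => e e0.
have H : \forall k \near \oo, forall i j, ball (L i j) e (s k i j).
  apply: filter_forall => i; apply: filter_forall => j.
  by have /cvg_ballP := sL i j; exact.
by near=> k; split => // i j; have /= := near H k; exact.
Unshelve. all: by end_near. Qed.

(** The factor n.+1 in c absorbs the number of terms in each entry of a product. *)
Lemma entry_exp_le A (c : R) : (forall i j, n.+1%:R * `|A i j| <= c) ->
  forall k i j, `|(A ^+ k) i j| <= c ^+ k.
Proof.
move=> Ac.
have c0 : 0 <= c by apply: le_trans (Ac ord0 ord0); rewrite mulr_ge0.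
elim=> [|k ih] i j.
  by rewrite !expr0 !mxE; case: eqP => _; rewrite ?normr1 ?normr0.
rewrite exprS mxE exprS; apply: (le_trans (ler_norm_sum _ _ _)).
apply: (@le_trans _ _ (\sum_(l < n.+1) (c / n.+1%:R * c ^+ k))); last first.
  by rewrite sumr_const card_ord -[leLHS]mulr_natl mulrA mulrCA mulfV ?mulr1// pnatr_eq0.
apply: ler_sum => l _; rewrite normrM ler_pM// ler_pdivlMr//.
by rewrite mulrC.
Qed.

Lemma expmx_first_order A : exists2 C : R, 0 <= C &
  forall h, 0 <= h <= 1 -> forall i j,
    `|expmx (h *: A) i j - (1%:M + h *: A) i j| <= C * h ^+ 2.
Proof.
pose a := \big[Num.max/0]_(p : 'I_n.+1 * 'I_n.+1) `|A p.1 p.2|.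
pose c := n.+1%:R * a.
have Ac i j : n.+1%:R * `|A i j| <= c.
  rewrite ler_pM2l//; exact: (@le_bigmax _ _ _ 0 (fun p => `|A p.1 p.2|) (i, j)).
have c0 : 0 <= c by apply: le_trans (Ac ord0 ord0); rewrite mulr_ge0.
(* For 0 <= h <= 1, the terms of order k >= 2 have entries at most h^2 c^k / k!, and these sum to at
   most h^2 exp(c). *)
exists (expR c); first exact: expR_ge0.
move=> h /andP[h0 h1] i j.
pose t i j k : R := k`!%:R^-1 * (h ^+ k * (A ^+ k) i j).
have tch i' j' k : `|t i' j' k| <= h ^+ k * exp_coeff c k.
  rewrite /t /exp_coeff /= !normrM normrX (ger0_norm h0) mulrCA ler_wpM2l ?exprn_ge0//.
  by rewrite mulrC ler_pM ?(entry_exp_le Ac)// ger0_norm// invr_ge0.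
have tc i' j' k : `|t i' j' k| <= exp_coeff c k.
  apply: (le_trans (tch _ _ _)); rewrite ler_piMl ?exprn_ile1//.
  exact: exp_coeff_ge0.
have cvgt i' j' : cvgn (series (t i' j')).
  apply: normed_cvg; apply: series_le_cvg (is_cvg_series_exp_coeff c) => k.
  - exact: normr_ge0.
  - exact: exp_coeff_ge0.
  - exact: tc.
have termE k i' j' : (k`!%:R^-1 *: (h *: A) ^+ k) i' j' = t i' j' k.
  by rewrite mxE exprZn mxE.
have sE k i' j' : series (fun k => k`!%:R^-1 *: (h *: A) ^+ k) k i' j' = series (t i' j') k.
  by rewrite /series /= summxE; apply: eq_bigr => l _; rewrite termE.
have -> : expmx (h *: A) i j = limn (series (t i j)).
  have : series (fun k => k`!%:R^-1 *: (h *: A) ^+ k) k @[k --> \oo] -->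
      (\matrix_(i', j') limn (series (t i' j')) : 'M[R]_n.+1).
    by apply: cvg_mx_entrywise => i' j'; under eq_fun do rewrite sE; rewrite mxE; exact: cvgt.
  by move=> /cvg_lim; rewrite /expmx => ->//; rewrite mxE.
have part k : (2 <= k)%N ->
    `|series (t i j) k - (1%:M + h *: A) i j| <= expR c * h ^+ 2.
  move=> k2; rewrite -(subnK k2) addnC /series/= big_nat_recl// big_nat_recl//.
  rewrite [X in _ - X](_ : _ = t i j 0%N + t i j 1%N); last first.
    by rewrite /t !expr0 !expr1 !mxE (_ : 1`! = 1%N)// fact0 invr1 !mul1r.
  rewrite [X in `|X|](_ : _ = \sum_(0 <= l < k - 2) t i j l.+2); last by ring.
  apply: (le_trans (ler_norm_sum _ _ _)).
  apply: (@le_trans _ _ (\sum_(0 <= l < k - 2) exp_coeff c l.+2 * h ^+ 2)).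
    apply: ler_sum => l _; apply: (le_trans (tch _ _ _)).
    rewrite mulrC ler_wpM2l ?(exp_coeff_ge0 _ c0)//.
    by rewrite -addn2 exprD ler_piMl ?exprn_ge0// exprn_ile1.
  rewrite -mulr_suml ler_wpM2r ?exprn_ge0//.
  apply: (@le_trans _ _ (series (exp_coeff c) k)).
    rewrite -(subnK k2) addnC /series/= big_nat_recl// big_nat_recl//= addrA.
    rewrite addKn lerDr.
    exact: (addr_ge0 (@exp_coeff_ge0 R c 0%N c0) (@exp_coeff_ge0 R c 1%N c0)).
  apply: nondecreasing_cvgn_le; last exact: is_cvg_series_exp_coeff.
  by apply: nondecreasing_series => l *; exact: exp_coeff_ge0.
have cl : `|series (t i j) k - (1%:M + h *: A) i j| @[k --> \oo] -->
    `|limn (series (t i j)) - (1%:M + h *: A) i j|.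
  by apply: cvg_norm; apply: cvgB; [exact: cvgt|exact: cvg_cst].
rewrite -(cvg_lim _ cl)//; apply: limr_le; first by apply/cvg_ex; eexists; exact: cl.
by near=> k; apply: part; near: k; exact: nbhs_infty_ge.
Unshelve. all: by end_near. Qed.

End matrix_exponential.

Section probability_integrals.
Context d (T : measurableType d) (R : realType) (Q : probability T R).
Implicit Types X : T -> R.

Lemma bounded_integrable X (K : R) : measurable_fun setT X ->
  (forall w, `|X w| <= K) -> Q.-integrable setT (EFin \o X).
Proof.
move=> mX XK; apply: (@le_integrable _ _ _ Q setT measurableT _ (EFin \o cst K)).
- exact/measurable_EFinP.
- by move=> w _; rewrite /= lee_fin (le_trans (XK w))// ler_norm.
- exact: finite_measure_integrable_cst.
Qed.

Lemma Rintegral_bounded X (K : R) : measurable_fun setT X ->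
  (forall w, `|X w| <= K) -> `|\int[Q]_w X w| <= K.
Proof.
move=> mX XK; have iX := bounded_integrable mX XK.
apply: (le_trans (le_normr_Rintegral measurableT iX)).
apply: (@le_trans _ _ (\int[Q]_(w in setT) K)).
  apply: le_Rintegral => //.
  - by apply: (bounded_integrable (K := K)) => [|w]; [exact: measurableT_comp|rewrite normr_id].
  - exact: finite_measure_integrable_cst.
rewrite Rintegral_cst// (_ : fine _ = 1) ?mulr1//.
by rewrite [X in fine X](_ : _ = 1%E)//; exact: probability_setT.
Qed.

End probability_integrals.

Lemma Rintegral_sum d (T : measurableType d) (R : realType)
    (mu : {measure set T -> \bar R}) (D : set T) (mD : measurable D)
    (I : Type) (s : seq I) (f : I -> T -> R) :
  (forall i, mu.-integrable D (EFin \o f i)) ->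
  \int[mu]_(x in D) (\sum_(i <- s) f i x) = \sum_(i <- s) \int[mu]_(x in D) f i x.
Proof.
move=> fi; elim: s => [|i s ih].
  by rewrite big_nil; under eq_Rintegral do rewrite big_nil; rewrite Rintegral_cst ?mul0r.
rewrite big_cons -ih -RintegralD//.
  by apply: eq_Rintegral => x _; rewrite big_cons.
rewrite (_ : EFin \o _ = (fun x => \sum_(j <- s) (EFin \o f j) x)%E).
  exact: integrable_sum.
by apply/funext => x /=; rewrite sumEFin.
Qed.

(** * Expectations over one short time step *)

Section first_order.
Context {R : realType} {m : nat}.
Local Notation path := (skorokhod R m).
Variables (G : 'M[R]_m.+1) (P : probability path R).
Hypothesis P_markov : markov_chain G P.
Variable i : 'I_m.+1.
Hypothesis P_start : (0 < P (start_at i))%E.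

Let Pi := start_law P i.

Let at_ (t : R) (k : 'I_m.+1) : set path := [set w | w t = k].

Let mat t k : measurable (at_ t k).
Proof. exact: (measurable_at t [set k]). Qed.

(** As Y factors through [stop], both integrals are taken against images under [stop] of
    restrictions of [Pi], and these images are proportional by [start_law_markov]. *)
Lemma markov_ge0_integral (a b : R) (a0 : 0 <= a) (k j : 'I_m.+1) (Y : path -> R) :
  a < b -> measurable_fun setT Y -> (forall w, 0 <= Y w) ->
  (forall w, Y (stop a0 w) = Y w) ->
  (\int[Pi]_(w in at_ a k `&` at_ b j) (Y w)%:E =
   (fine (Pi (at_ a k `&` at_ b j)) / fine (Pi (at_ a k)))%:E *
   \int[Pi]_(w in at_ a k) (Y w)%:E)%E.
Proof.
move=> ab mY Y0 Ystop; set q := fine _ / _.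
have q0 : 0 <= q by rewrite divr_ge0// fine_ge0.
have mD1 : measurable (at_ a k `&` at_ b j) by exact: measurableI.
have mEY : measurable_fun setT (EFin \o Y) by exact/measurable_EFinP.
have push D (mD : measurable D) : (\int[Pi]_(w in D) (Y w)%:E =
    \int[pushforward (mrestr Pi mD) (stop a0)]_w (Y w)%:E)%E.
  rewrite ge0_integral_pushforward//; last 2 first.
  - exact: measurable_stop.
  - by move=> w _; rewrite lee_fin.
  rewrite preimage_setT integral_mrestr.
    by apply: eq_integral => w _; rewrite /= Ystop.
  by apply: measurableT_comp => //; exact: measurable_stop.
rewrite (push _ mD1) (push _ (mat a k)).
rewrite -[q]/((NngNum q0)%:num) -ge0_integral_mscale//.
- exact: measurable_stop.
- move=> ms; apply: eq_measure_integral => A mA _.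
  change (Pi (stop a0 @^-1` A `&` (at_ a k `&` at_ b j)) =
    q%:E * Pi (stop a0 @^-1` A `&` at_ a k))%E.
  by rewrite setIC (start_law_markov P_markov P_start a0 k j ab mA) [in RHS]setIC.
- by move=> w _; rewrite lee_fin.
Qed.

Lemma markov_integral (a b : R) (a0 : 0 <= a) (k j : 'I_m.+1) (Y : path -> R) (K : R) :
  a < b -> measurable_fun setT Y -> (forall w, `|Y w| <= K) ->
  (forall w, Y (stop a0 w) = Y w) ->
  \int[Pi]_w (\1_(at_ a k `&` at_ b j) w * Y w) =
  expmx ((b - a) *: G) k j * \int[Pi]_w (\1_(at_ a k) w * Y w).
Proof.
move=> ab mY YK Ystop.
have mD1 : measurable (at_ a k `&` at_ b j) by exact: measurableI.
have YI : Pi.-integrable setT (EFin \o Y) by exact: bounded_integrable mY YK.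
have cstI (c : R) : Pi.-integrable setT (EFin \o cst c) by exact: finite_measure_integrable_cst.
have indE D : \int[Pi]_w (\1_D w * Y w) = \int[Pi]_(w in D) Y w.
  rewrite [RHS]Rintegral_mkcond; apply: eq_Rintegral => w _.
  by rewrite indicE patchE; case: ifPn => _; rewrite ?mul1r ?mul0r.
rewrite !indE.
set q := fine (Pi (at_ a k `&` at_ b j)) / fine (Pi (at_ a k)).
have ge0E (Z : path -> R) : Pi.-integrable setT (EFin \o Z) ->
    (forall w, 0 <= Z w) -> (forall w, Z (stop a0 w) = Z w) ->
    \int[Pi]_(w in at_ a k `&` at_ b j) Z w = q * \int[Pi]_(w in at_ a k) Z w.
  move=> ZI Z0 Zs; have /integrableP[/measurable_EFinP mZ _] := ZI.
  rewrite /Rintegral (markov_ge0_integral k j ab mZ Z0 Zs) fineM//.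
  by apply: integrable_fin_num => //; exact: integrableS ZI.
(* Adding the constant K makes Y nonnegative, and constants are themselves covered by the
   nonnegative case. *)
have YKE D : measurable D -> \int[Pi]_(w in D) Y w =
    \int[Pi]_(w in D) (Y w + K) - \int[Pi]_(w in D) K.
  move=> mD; rewrite RintegralD ?addrK//; first exact: integrableS YI.
  exact: integrableS (cstI K).
have K0 : 0 <= K by rewrite (le_trans _ (YK point)).
rewrite YKE// [in RHS]YKE// ge0E; last 3 first.
- exact: (integrableD measurableT YI (cstI K)).
- by move=> w; have := YK w; rewrite ler_norml; lra.
- by move=> w; rewrite Ystop.
rewrite (ge0E (cst K))// -mulrBr.
(* On a null event the remaining integral is zero, so the factors need not agree; otherwise q is the
   transition probability. *)
have [D20|D20] := eqVneq (Pi (at_ a k)) 0%E.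
  rewrite -YKE// (_ : \int[Pi]_(w in at_ a k) Y w = 0) ?mulr0//.
  by rewrite /Rintegral null_set_integral//; exact/measurable_EFinP/measurable_funTS.
congr (_ * _); rewrite /q.
have D2E : at_ a k = fdim_event [:: (a, k)].
  rewrite fdim_event_cons (_ : fdim_event [::] = setT) ?setIT//.
  by apply/seteqP; split.
rewrite [at_ a k `&` _]setIC D2E (start_law_markov_fdim P_markov P_start)//.
rewrite fineM ?fin_num_measure//= ?mulfK//.
  by rewrite fine_eq0 -?D2E// fin_num_measure.
exact: measurable_fdim_event.
Qed.

(** Split according to the states k at a and j at b, the three expectations are combinations of the
    same numbers [y k j], with coefficients from the exponential, the identity and G; the entrywise
    expansion of the exponential concludes. One C serves all a, b, Y, so the errors can be added
    over a mesh. *)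
Lemma markov_first_order : exists2 C : R, 0 <= C &
  forall (a b K : R) (a0 : 0 <= a) (Y : 'I_m.+1 -> path -> R),
  a < b <= a + 1 -> (forall j, measurable_fun setT (Y j)) ->
  (forall j w, `|Y j w| <= K) -> (forall j w, Y j (stop a0 w) = Y j w) ->
  `|\int[Pi]_w (Y (w b) w) - \int[Pi]_w (Y (w a) w) -
    (b - a) * \int[Pi]_w (\sum_j G (w a) j * Y j w)| <= C * K * (b - a) ^+ 2.
Proof.
have [C C0 HC] := expmx_first_order G.
exists (\sum_(k < m.+1) \sum_(j < m.+1) C); first by do 2 apply: sumr_ge0 => ? _.
move=> a b K a0 Y /andP[ab ba1] mY YK Ystop.
have K0 : 0 <= K by rewrite (le_trans _ (YK ord0 point)).
pose y k j := \int[Pi]_w (\1_(at_ a k) w * Y j w).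
have yI k j : Pi.-integrable setT (EFin \o (fun w => \1_(at_ a k) w * Y j w)).
  apply: (@bounded_integrable _ _ _ _ _ K).
    by apply: measurable_funM => //; exact: measurable_indic.
  by move=> w; rewrite indicE; case: (_ \in _); rewrite ?mul1r// mul0r normr0.
have yK k j : `|y k j| <= K.
  apply: Rintegral_bounded.
    by apply: measurable_funM => //; exact: measurable_indic.
  by move=> w; rewrite indicE; case: (_ \in _); rewrite ?mul1r// mul0r normr0.
have sum_at t w (F : 'I_m.+1 -> R) : \sum_k \1_(at_ t k) w * F k = F (w t).
  rewrite (bigD1 (w t))//= indicE mem_set// mul1r big1 ?addr0// => k kw.
  by rewrite indicE memNset ?mul0r// => /eqP; rewrite eq_sym (negbTE kw).
have lin (c : 'I_m.+1 -> 'I_m.+1 -> R) :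
    \int[Pi]_w (\sum_k \sum_j c k j * (\1_(at_ a k) w * Y j w)) =
    \sum_k \sum_j c k j * y k j.
  have cyI k j : Pi.-integrable setT (EFin \o (fun w => c k j * (\1_(at_ a k) w * Y j w))).
    exact: (integrableZl measurableT (c k j) (yI k j)).
  rewrite Rintegral_sum//.
    apply: eq_bigr => k _; rewrite Rintegral_sum//; apply: eq_bigr => j _.
    exact: RintegralZl.
  move=> k; rewrite (_ : EFin \o _ = (fun w => \sum_j (c k j * (\1_(at_ a k) w * Y j w))%:E)%E).
    by apply: (integrable_sum measurableT) => j _; exact: cyI.
  by apply/funext => w /=; rewrite sumEFin.
have E1 : \int[Pi]_w (Y (w b) w) = \sum_k \sum_j expmx ((b - a) *: G) k j * y k j.
  transitivity (\int[Pi]_w (\sum_k \sum_j \1_(at_ a k `&` at_ b j) w * Y j w)).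
    apply: eq_Rintegral => w _; rewrite -(sum_at b w (Y^~ w)).
    rewrite exchange_big/=; apply: eq_bigr => j _.
    rewrite -mulr_suml; congr (_ * _); rewrite -[LHS](sum_at a w (fun=> \1_(at_ b j) w)).
    by apply: eq_bigr => k _; rewrite indicI.
  have I1 k j : Pi.-integrable setT (EFin \o (fun w => \1_(at_ a k `&` at_ b j) w * Y j w)).
    apply: (@bounded_integrable _ _ _ _ _ K).
      apply: measurable_funM => //; apply: measurable_indic; exact: measurableI.
    by move=> w; rewrite indicE; case: (_ \in _); rewrite ?mul1r// mul0r normr0.
  rewrite Rintegral_sum//.
    apply: eq_bigr => k _; rewrite Rintegral_sum//; apply: eq_bigr => j _.
    exact: (markov_integral k j ab (mY j) (YK j) (Ystop j)).
  move=> k; rewrite (_ : EFin \o _ = (fun w => \sum_j (\1_(at_ a k `&` at_ b j) w * Y j w)%:E)%E).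
    by apply: (integrable_sum measurableT) => j _; exact: I1.
  by apply/funext => w /=; rewrite sumEFin.
have E2 : \int[Pi]_w (Y (w a) w) = \sum_k \sum_j (1%:M : 'M[R]_m.+1) k j * y k j.
  rewrite -lin; apply: eq_Rintegral => w _; rewrite -(sum_at a w (Y^~ w)).
  apply: eq_bigr => k _; rewrite (bigD1 k)//= mxE eqxx mul1r big1 ?addr0// => j jk.
  by rewrite mxE eq_sym (negbTE jk) mul0r.
have E3 : \int[Pi]_w (\sum_j G (w a) j * Y j w) = \sum_k \sum_j G k j * y k j.
  rewrite -lin; apply: eq_Rintegral => w _.
  rewrite -(sum_at a w (fun k => \sum_j G k j * Y j w)).
  by apply: eq_bigr => k _; rewrite mulr_sumr; apply: eq_bigr => j _; rewrite mulrCA.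
rewrite E1 E2 E3 mulr_sumr -!sumrB.
apply: (le_trans (ler_norm_sum _ _ _)); rewrite !mulr_suml; apply: ler_sum => k _.
rewrite mulr_sumr -!sumrB.
apply: (le_trans (ler_norm_sum _ _ _)); rewrite ?mulr_suml; apply: ler_sum => j _.
rewrite mulrA -!mulrBl normrM mulrAC ler_pM//.
have ba : 0 <= b - a <= 1 by apply/andP; split; lra.
have := HC _ ba k j; rewrite mxE [(_ *: G) k j]mxE.
by rewrite opprD addrA.
Qed.

End first_order.

Section locally_lipschitz.
Context {R : realType} {V W : normedModType R}.

(* The library's local Lipschitz condition ranges over pairs of points, so one
   covering of K x K suffices. *)
Lemma locally_lipschitz_compact (u : V -> W) (A K : set V) :
  [locally [lipschitz u x | x in A]] -> K `<=` A -> compact K ->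
  exists2 L : R, 0 <= L & forall x y, K x -> K y -> `|u x - u y| <= L * `|x - y|.
Proof.
move=> ulip KA Kc.
have := compact_setX Kc Kc; rewrite compact_near_coveringP.
move=> /(_ R (pinfty_nbhs R) (fun M p => A p.1 -> A p.2 ->
   `|u p.1 - u p.2| <= M * `|p.1 - p.2|)) [].
  move=> [x y] [/= Kx Ky].
  have := ulip (x, y) (conj (KA _ Kx) (KA _ Ky)).
  case=> M [Mr MM].
  (* The Lipschitz bound is granted for constants strictly above M, whence M + 1. *)
  have M1 : \forall p \near (x, y), A p.1 -> A p.2 ->
      `|u p.1 - u p.2| <= (M + 1) * `|p.1 - p.2|.
    have := MM (M + 1); rewrite ltrDl ltr01 => /(_ isT).
    rewrite /dominated_by /within /= => H.
    by apply: filterS H => p H Ap1 Ap2; exact: (H (conj Ap1 Ap2)).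
  exists ([set p | A p.1 -> A p.2 -> `|u p.1 - u p.2| <= (M + 1) * `|p.1 - p.2|],
          [set M' | M + 1 <= M']) => /=.
    by split => //; exact: nbhs_pinfty_ge (num_real _).
  move=> [p M'] /= [pM MM'] Ap1 Ap2; apply: le_trans (pM Ap1 Ap2) _.
  by rewrite ler_wpM2r.
move=> M [Mr MK]; exists (Num.max 0 (M + 1)); first by rewrite le_max lexx.
move=> x y Kx Ky; have := MK (M + 1); rewrite ltrDl ltr01.
move=> /(_ isT (x, y) (conj Kx Ky) (KA _ Kx) (KA _ Ky)) /= /le_trans; apply.
by rewrite ler_wpM2r// le_max lexx orbT.
Qed.

End locally_lipschitz.

Lemma Rintegral_dominated_cvg d (T : measurableType d) (R : realType)
    (mu : {measure set T -> \bar R}) (D : set T) (mD : measurable D)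
    (f_ : nat -> T -> R) (f g : T -> R) :
  (forall n, measurable_fun D (f_ n)) ->
  (forall x, D x -> f_ n x @[n --> \oo] --> f x) ->
  mu.-integrable D (EFin \o g) ->
  (forall n x, D x -> `|f_ n x| <= g x) ->
  mu.-integrable D (EFin \o f) /\
  \int[mu]_(x in D) f_ n x @[n --> \oo] --> \int[mu]_(x in D) f x.
Proof.
move=> mf_ f_f ig f_g.
have [|||||fi _ cv] := @dominated_convergence _ _ _ mu D mD
  (fun n => EFin \o f_ n) (EFin \o f) (EFin \o g) => //.
- by move=> n; exact/measurable_EFinP.
- exact/measurable_EFinP/(measurable_fun_cvg mf_).
- by apply: aeW => x Dx; apply: cvg_EFin; [exact: nearW|exact: f_f].
- by apply: aeW => x n Dx; rewrite /= lee_fin f_g.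
split => //; apply: fine_cvg.
by rewrite /Rintegral fineK ?integrable_fin_num.
Qed.

(** * Riemann sums evaluated at right end points *)

Section right_riemann.
Context {R : realType}.
Notation mu := (@lebesgue_measure R).
Variable t : R.
Hypothesis t0 : 0 < t.

Definition mesh_pt (n c : nat) : R := t / n.+1%:R * c%:R.

Definition mesh_cell n c : set R := `]mesh_pt n c, mesh_pt n c.+1]%classic.

Let h_gt0 n : 0 < t / n.+1%:R. Proof. by rewrite divr_gt0. Qed.

Lemma mesh_ptS n c : mesh_pt n c.+1 = mesh_pt n c + t / n.+1%:R.
Proof. by rewrite /mesh_pt -[c.+1]addn1 natrD mulrDr mulr1. Qed.

Lemma le_mesh_pt n : {homo mesh_pt n : c d / (c <= d)%N >-> c <= d}.
Proof. by move=> c d cd; rewrite /mesh_pt ler_pM2l// ler_nat. Qed.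

Lemma mesh_pt0 n : mesh_pt n 0 = 0. Proof. by rewrite /mesh_pt mulr0. Qed.

Lemma mesh_pt_last n : mesh_pt n n.+1 = t.
Proof. by rewrite /mesh_pt divfK// pnatr_eq0. Qed.

Lemma mesh_cell_sub n c : (c < n.+1)%N -> mesh_cell n c `<=` `]0, t].
Proof.
move=> cn; apply: subset_itv; rewrite bnd_simp.
  by rewrite -(mesh_pt0 n) le_mesh_pt.
by rewrite -(mesh_pt_last n) le_mesh_pt.
Qed.

Lemma mesh_cell_cover n r : 0 < r <= t -> exists2 c, (c < n.+1)%N & mesh_cell n c r.
Proof.
move=> /andP[r0 rt].
have ex : exists c, r <= mesh_pt n c by exists n.+1; rewrite mesh_pt_last.
case: (ex_minnP ex) => -[|c] rc minc.
  by move: rc; rewrite mesh_pt0 leNgt r0.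
exists c; first by apply: minc; rewrite mesh_pt_last.
rewrite /mesh_cell /= in_itv/= rc andbT ltNge; apply/negP => /minc.
by rewrite ltnn.
Qed.

Lemma mesh_cell_inj n c d r : mesh_cell n c r -> mesh_cell n d r -> c = d.
Proof.
wlog cd : c d / (c <= d)%N.
  move=> H rc rd; have [/H|/ltnW/H H'] := leqP c d; first exact.
  by apply/esym/H'.
rewrite /mesh_cell /= !in_itv/= => /andP[_ rc] /andP[dr _].
apply/eqP; rewrite eqn_leq cd/= leqNgt; apply/negP => cd'.
by have := lt_le_trans dr (le_trans rc (le_mesh_pt n cd')); rewrite ltxx.
Qed.

Definition step_sum (Phi : R -> R -> R) n r : R :=
  \sum_(c < n.+1) \1_(mesh_cell n c) r * Phi (mesh_pt n c.+1) r.

Lemma step_sumE Phi n r c : (c < n.+1)%N -> mesh_cell n c r ->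
  step_sum Phi n r = Phi (mesh_pt n c.+1) r.
Proof.
move=> cn rc; rewrite /step_sum (bigD1 (Ordinal cn))//= indicE mem_set// mul1r.
rewrite big1 ?addr0// => d dc; rewrite indicE memNset ?mul0r// => rd.
by move: dc; rewrite -val_eqE /= (mesh_cell_inj rd rc) eqxx.
Qed.

(** The right end point of the cell containing r tends to r from the right, so right continuity in
    the first argument suffices for dominated convergence. The bound uniform in n serves a second
    dominated convergence, over paths. *)
Lemma right_riemann_cvg (Phi : R -> R -> R) (D : R -> R) :
  (forall p, measurable_fun setT (Phi p)) ->
  mu.-integrable `]0, t] (EFin \o D) ->
  (forall p r, `|Phi p r| <= D r) ->
  (forall r, 0 < r <= t -> Phi p r @[p --> r^'+] --> Phi r r) ->
  [/\ mu.-integrable `]0, t] (EFin \o (fun r => Phi r r)),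
    \sum_(c < n.+1) \int[mu]_(r in mesh_cell n c) Phi (mesh_pt n c.+1) r @[n --> \oo]
      --> \int[mu]_(r in `]0, t]) Phi r r &
    forall n, `|\sum_(c < n.+1) \int[mu]_(r in mesh_cell n c) Phi (mesh_pt n c.+1) r|
      <= \int[mu]_(r in `]0, t]) D r].
Proof.
move=> mPhi iD PhiD Phic.
have mI : measurable (`]0, t] : set R) by [].
have mind n c : measurable_fun setT (\1_(mesh_cell n c) : R -> R).
  by apply: measurable_indic; exact: measurable_itv.
have [||||iPhi cv] := @Rintegral_dominated_cvg _ _ _ mu _ mI (step_sum Phi)
    (fun r => Phi r r) D.
- move=> n; apply: measurable_funTS; apply: measurable_sum => c.
  by apply: measurable_funM; [exact: mind|exact: mPhi].
- move=> r; rewrite /= in_itv/= => rt; apply/cvgrPdist_le => e e0.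
  have /cvgrPdist_le/(_ _ e0) [d /= d0 dr] := Phic _ rt.
  exists (Num.bound (t / d)) => // n /= nd.
  have [c cn rc] := mesh_cell_cover n rt.
  rewrite (step_sumE _ cn rc).
  move: (rc); rewrite /mesh_cell /= in_itv/= => /andP[cr rc'].
  (* The filter [r^'+] says nothing about r itself, so the case where r is an end point is treated
     apart. *)
  have [->|rne] := eqVneq r (mesh_pt n c.+1); first by rewrite subrr normr0 ltW.
  apply: dr; last by rewrite lt_neqAle rne.
  rewrite /= distrC ger0_norm ?subr_ge0//.
  have hd : t / n.+1%:R < d.
    rewrite ltr_pdivrMr// mulrC -ltr_pdivrMr//.
    apply: (lt_le_trans (archi_boundP _)); first by rewrite divr_ge0// ltW.
    by rewrite ler_nat (leq_trans nd).
  move: cr rc' hd; rewrite mesh_ptS; move: (mesh_pt n c) (t / n.+1%:R) => x q.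
  lra.
- exact: iD.
- move=> n r; rewrite /= in_itv/= => rt.
  by have [c cn rc] := mesh_cell_cover n rt; rewrite (step_sumE _ cn rc).
have termI n c : mu.-integrable `]0, t]
    (EFin \o (fun r => \1_(mesh_cell n c) r * Phi (mesh_pt n c.+1) r)).
  apply: (@le_integrable _ _ _ mu _ mI _ (EFin \o D)) => //.
    apply/measurable_EFinP/measurable_funTS/measurable_funM; last exact: mPhi.
    exact: mind.
  move=> r _; rewrite /= lee_fin (le_trans _ (ler_norm _))// indicE.
  by case: (_ \in _); rewrite ?mul1r ?mul0r ?normr0 ?PhiD ?(le_trans _ (PhiD 0 r)).
have sumE n : \sum_(c < n.+1) \int[mu]_(r in mesh_cell n c) Phi (mesh_pt n c.+1) r =
    \int[mu]_(r in `]0, t]) step_sum Phi n r.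
  rewrite /step_sum Rintegral_sum//.
  apply: eq_bigr => c _; rewrite [LHS]Rintegral_mkcond [RHS]Rintegral_mkcond.
  apply: eq_Rintegral => r _; rewrite !patchE indicE.
  have [rc|rc] := boolP (r \in mesh_cell n c).
    rewrite mul1r ifT// inE; apply: (mesh_cell_sub (ltn_ord c)).
    by move: rc; rewrite inE.
  by rewrite mul0r if_same.
have stepI n : mu.-integrable `]0, t] (EFin \o step_sum Phi n).
  have := @integrable_sum _ _ _ mu _ mI 'I_n.+1 (index_enum _) xpredT
    (fun c => EFin \o (fun r => \1_(mesh_cell n c) r * Phi (mesh_pt n c.+1) r))
    (fun c _ => termI n c).
  by apply: eq_integrable => // r _; rewrite /= /step_sum -sumEFin.
split => //; first by under eq_fun do rewrite sumE.
move=> n; rewrite sumE; apply: (le_trans (@le_normr_Rintegral _ _ _ mu _ _ mI (stepI n))).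
apply: le_Rintegral => //.
  exact: (@integrable_norm _ _ _ mu _ _ (stepI n)).
move=> r; rewrite /= in_itv/= => rt.
by have [c cn rc] := mesh_cell_cover n rt; rewrite (step_sumE _ cn rc).
Qed.

End right_riemann.

Lemma ae_imply d (T : measurableType d) (R : realType)
    (mu : {measure set T -> \bar R}) (P Q : T -> Prop) :
  {ae mu, forall x, P x} -> (forall x, P x -> Q x) -> {ae mu, forall x, Q x}.
Proof.
by move=> aP PQ; apply: (@filterS _ _ (ae_filter_ringOfSetsType mu) _ _ PQ).
Qed.

Lemma ae_and d (T : measurableType d) (R : realType)
    (mu : {measure set T -> \bar R}) (P Q : T -> Prop) :
  {ae mu, forall x, P x} -> {ae mu, forall x, Q x} ->
  {ae mu, forall x, P x /\ Q x}.
Proof.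
by move=> aP aQ; apply: (@filterI _ _ (ae_filter_ringOfSetsType mu)).
Qed.

Section abs_cont_paths.
Context {R : realType}.
Notation mu := (@lebesgue_measure R).

Lemma abs_cont_continuous (h : R -> R) : abs_cont h -> continuous h.
Proof.
move=> hac x; apply/cvgrPdist_le => e e0; have [d d0 hd] := hac e e0.
exists d => //= y; rewrite /ball/= => xy.
have [xley|yltx] := leP x y.
  have := hd x [:: (x, y)]; rewrite /= lexx xley /mesh /jumps !big_seq1/= distrC.
  by apply => //; rewrite -[y - x]ger0_norm ?subr_ge0// distrC.
have := hd y [:: (y, x)]; rewrite /= lexx (ltW yltx) /mesh /jumps !big_seq1/=.
by apply => //; rewrite -[x - y]ger0_norm// subr_ge0 ltW.
Qed.

(** A Radon-Nikodym density is chosen separately for each function; [derive1 h] is a canonical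
    version, which for a family of paths is jointly measurable, as Fubini's theorem requires. *)
Lemma abs_cont_derive1_integral (h : R -> R) (T : R) :
  (forall x, h x = h (clamp T x)) -> 0 <= T -> abs_cont h ->
  measurable_fun setT (derive1 h) ->
  [/\ mu.-integrable `]0, T] (EFin \o derive1 h),
      (\int[mu]_(x in `]0%R, T]) `|derive1 h x|%:E <=
        (2 * fine (total_variation 0 T h) + `|h T - h 0|)%:E)%E,
      forall a b, 0 <= a -> a <= b -> b <= T ->
        \int[mu]_(x in `]a, b]) derive1 h x = h b - h a &
      {ae mu, forall x, 0 < x -> derivable h x 1}].
Proof.
move=> hT T0 hac mh.
have [g [gI gle gE gae]] := abs_cont_integral hT T0 hac.
have aeq (a b : R) : 0 <= a -> ae_eq mu [set` `]a, b]] (EFin \o derive1 h) (EFin \o g).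
  move=> a0; apply: (ae_imply gae) => x + /itvP xab.
  by move=> [|_ /= ->//]; rewrite (le_lt_trans a0)// xab.
have mhE (a b : R) : measurable_fun [set` `]a, b]] (EFin \o derive1 h).
  exact/measurable_EFinP/measurable_funTS.
have mgE (a b : R) : measurable_fun [set` `]a, b]] (EFin \o g).
  by have /integrableP[mg _] := gI; exact: measurable_funS mg.
have absE : (\int[mu]_(x in `]0%R, T]) `|derive1 h x|%:E =
    \int[mu]_(x in `]0%R, T]) `|g x|%:E)%E.
  apply: ge0_ae_eq_integral.
  - exact: measurable_itv.
  - have mh0 : measurable_fun [set` `]0, T]] (derive1 h) by have /measurable_EFinP := mhE 0 T.
    apply/measurable_EFinP; exact: (measurableT_comp (@normr_measurable R setT) mh0).
  - have mg0 : measurable_fun [set` `]0, T]] g by have /measurable_EFinP := mgE 0 T.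
    apply/measurable_EFinP; exact: (measurableT_comp (@normr_measurable R setT) mg0).
  - by [].
  - by [].
  - by apply: (ae_imply (aeq 0 T (lexx 0))) => x H xD; have := H xD => -[->].
have le : (\int[mu]_(x in `]0%R, T]) `|derive1 h x|%:E <=
        (2 * fine (total_variation 0 T h) + `|h T - h 0|)%:E)%E.
  rewrite absE; apply: le_trans gle; apply: ge0_subset_integral => //.
  by apply/measurable_EFinP/measurableT_comp => //; have /integrableP[/measurable_EFinP] := gI.
split => //.
- by apply/integrableP; split; [exact: (mhE 0 T)|exact: le_lt_trans le (ltry _)].
- move=> a b a0 ab bT; rewrite -gE// /Rintegral; congr fine.
  apply: ae_eq_integral; [exact: measurable_itv|exact: (mhE a b)|exact: (mgE a b)|].
  exact: (aeq a b a0).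
- by apply: (ae_imply gae) => x H /H[].
Qed.

End abs_cont_paths.

(** By Tonelli the measures of the x-sections have integral zero, and a nonnegative function with
    zero integral vanishes almost everywhere. *)
Lemma ae_null_xsection d1 d2 (T1 : measurableType d1) (T2 : measurableType d2)
    (R : realType) (m1 : {sigma_finite_measure set T1 -> \bar R})
    (m2 : {sigma_finite_measure set T2 -> \bar R}) (A : set (T1 * T2)) :
  measurable A -> (forall y, m1 (ysection A y) = 0%E) ->
  {ae m1, forall x, m2 (xsection A x) = 0%E}.
Proof.
move=> mA A0.
have := indic_fubini_tonelli m1 m2 mA.
rewrite (indic_fubini_tonelli_FE m2 mA) (indic_fubini_tonelli_GE m1 mA).
rewrite [X in _ = X -> _](_ : _ = 0%E); last first.
  by apply: integral0_eq => y _; exact: A0.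
move=> I0; have mphi := measurable_fun_xsection m2 mA.
have : (\int[m1]_x `|(m2 \o xsection A) x| = 0)%E.
  by rewrite -[RHS]I0; apply: eq_integral => x _; rewrite gee0_abs.
move/(ae_eq_integral_abs m1 measurableT mphi) => ae0.
by apply: (ae_imply ae0) => x /(_ I).
Qed.

(** * Differentiating the expectation *)

Section expectation_derivative.
Context {R : realType} {m : nat}.
Local Notation path := (skorokhod R m).
Notation mu := (@lebesgue_measure R).
Variables (G : 'M[R]_m.+1) (P : probability path R).
Hypothesis P_markov : markov_chain G P.
Variable i0 : 'I_m.+1.
Hypothesis P_start : (0 < P (start_at i0))%E.

Let Pi := start_law P i0.

Variables (T K : R) (f : 'I_m.+1 -> R -> path -> R).
Hypotheses (T0 : 0 < T) (mf : forall k t, measurable_fun setT (f k t)).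
Hypothesis fac : forall e : R, 0 < e ->
  exists2 d : R, 0 < d & forall k w, abs_cont_modulus (f k ^~ w) e d.
Hypotheses (fT : forall k t w, f k t w = f k (clamp T t) w)
  (fK : forall k t w, `|f k t w| <= K)
  (fstop : forall k a (a0 : 0 <= a) w, f k a (stop a0 w) = f k a w).

Let g k (x : R * path) : R := derive1 (f k ^~ x.2) x.1.

Let fac1 k w : abs_cont (f k ^~ w).
Proof. by move=> e /fac[d d0 hd]; exists d. Qed.

Let fcont k w : continuous (f k ^~ w).
Proof. exact: abs_cont_continuous. Qed.

Let mg k : measurable_fun setT (g k).
Proof. exact: (measurable_derive1 (mf k) (@fcont k)). Qed.

Let mgw k w : measurable_fun setT (fun r => g k (r, w)).
Proof. exact: (measurableT_comp (mg k) (pair2_measurable w)). Qed.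

Let K0 : 0 <= K. Proof. exact: le_trans (normr_ge0 _) (fK ord0 0 point). Qed.

(** C is independent of k and w because [fac] gives them all one modulus: M bounds every total
    variation on [0, T], and K + K bounds the net increments. *)
Let gpath : exists2 C : R, 0 <= C & forall k w,
  [/\ mu.-integrable `]0, T] (EFin \o (fun r => g k (r, w))),
      (\int[mu]_(r in `]0%R, T]) `|g k (r, w)|%:E <= C%:E)%E,
      forall a b, 0 <= a -> a <= b -> b <= T ->
        \int[mu]_(r in `]a, b]) g k (r, w) = f k b w - f k a w &
      {ae mu, forall x, 0 < x -> derivable (f k ^~ w) x 1}].
Proof.
have [d d0 hd] := fac ltr01.
pose M : R := 1 *+ Num.bound ((T - 0) / (d / 2)).
exists (2 * M + (K + K)).
  by rewrite addr_ge0 ?addr_ge0// mulr_ge0// mulrn_wge0.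
move=> k w.
have [gI gle gE gd] := abs_cont_derive1_integral (fT k ^~ w) (ltW T0) (fac1 k w) (mgw k w).
split => //; apply: (le_trans gle); rewrite lee_fin lerD//.
  rewrite ler_pM2l// -lee_fin fineK.
    exact: (abs_cont_modulus_total_variation (hd k w) d0 (ltW T0)).
  exact: (abs_cont_total_variation_fin_num (fac1 k w) (ltW T0)).
by apply: (le_trans (ler_normB _ _)); rewrite lerD.
Qed.

Let C := s2val (cid2 gpath).
Let C0 : 0 <= C. Proof. exact: s2valP (cid2 gpath). Qed.
Let gI k w : mu.-integrable `]0, T] (EFin \o (fun r => g k (r, w))).
Proof. by have [] := s2valP' (cid2 gpath) k w. Qed.
Let gC k w : (\int[mu]_(r in `]0%R, T]) `|g k (r, w)|%:E <= C%:E)%E.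
Proof. by have [] := s2valP' (cid2 gpath) k w. Qed.
Let gE k w a b : 0 <= a -> a <= b -> b <= T ->
  \int[mu]_(r in `]a, b]) g k (r, w) = f k b w - f k a w.
Proof. by case: gpath => c c0 /(_ k w)[_ _ + _]; apply. Qed.
Let gD k w : {ae mu, forall x, 0 < x -> derivable (f k ^~ w) x 1}.
Proof. by case: gpath => c c0 /(_ k w)[]. Qed.

Let drift p (w : path) : R := \sum_j G (w p) j * f j p w.
Let Psi (x : R * path) : R := drift x.1 x.2 + g (x.2 x.1) x.
Let F t : R := \int[Pi]_w f (w t) t w.
Let theta t : R := \int[Pi]_w drift t w.

Let A : R := \sum_k \sum_j `|G k j| * K.

Let driftA p w : `|drift p w| <= A.
Proof.
apply: (@le_trans _ _ (\sum_j `|G (w p) j| * K)).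
  by apply: (le_trans (ler_norm_sum _ _ _)); apply: ler_sum => j _; rewrite normrM ler_wpM2l.
rewrite /A [leRHS](bigD1 (w p))//= lerDl; apply: sumr_ge0 => k _; apply: sumr_ge0 => j _.
exact: mulr_ge0.
Qed.

(** Turns an index given by the random state into a finite sum over deterministic states;
    measurability of such quantities comes from here. *)
Let sum_state (w : path) t (H : 'I_m.+1 -> R) : \sum_k (w t == k :> 'I_m.+1)%:R * H k = H (w t).
Proof.
rewrite (bigD1 (w t))//= eqxx mul1r big1 ?addr0// => k kw.
by rewrite eq_sym (negbTE kw) mul0r.
Qed.

Let mstate t k : measurable_fun setT (fun w : path => (w t == k)%:R : R).
Proof.
rewrite (_ : (fun w : path => _) = \1_[set w : path | w t = k]).
  by apply: measurable_indic; exact: (measurable_at t [set k]).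
apply/funext => w; rewrite indicE; congr (nat_of_bool _)%:R.
by apply/eqP/idP => [wk|/set_mem//]; apply/mem_set.
Qed.

Let mat_state t (H : 'I_m.+1 -> path -> R) : (forall k, measurable_fun setT (H k)) ->
  measurable_fun setT (fun w : path => H (w t) w).
Proof.
move=> mH; rewrite (_ : (fun w => _) = (fun w : path => \sum_k (w t == k)%:R * H k w)).
  by apply: measurable_sum => k; exact: measurable_funM.
by apply/funext => w; rewrite (sum_state w t (H ^~ w)).
Qed.

Let mdrift p : measurable_fun setT (drift p).
Proof.
apply: (@mat_state p (fun k w => \sum_j G k j * f j p w)) => k.
by apply: measurable_sum => j; apply: measurable_funM => //; exact: measurable_cst.
Qed.

Let mPsi : measurable_fun setT Psi.
Proof.
pose S k (x : R * path) : R := (x.2 x.1 == k)%:R.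
(* The indicator of a state is right-continuous in time, which yields its joint measurability. *)
have mS k : measurable_fun setT (S k).
  apply: (@measurable_fun_right_continuous _ path R (fun t (w : path) => (w t == k)%:R)).
    by move=> t; exact: mstate.
  move=> w t; apply: cvg_near_cst; apply: filterS (path_right_cst w t).
  by move=> s ->.
rewrite (_ : Psi = (fun x => \sum_k S k x * ((\sum_j G k j * f j x.1 x.2) + g k x))).
  apply: measurable_sum => k; apply: measurable_funM => //; apply: measurable_funD => //.
  apply: measurable_sum => j; apply: measurable_funM; first exact: measurable_cst.
  exact: (measurable_fun_continuous (mf j) (@fcont j)).
apply/funext => x.
by rewrite (sum_state x.2 x.1 (fun k => (\sum_j G k j * f j x.1 x.2) + g k x)).
Qed.

(* With the state frozen at the right end point p of a cell, the second term
   integrates over the cell to an increment of a single f_k. *)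
Let Phi (w : path) p r : R := drift p w + g (w p) (r, w).
Let Dom (w : path) r : R := A + \sum_k `|g k (r, w)|.

Let PhiD w p r : `|Phi w p r| <= Dom w r.
Proof.
apply: (le_trans (ler_normD _ _)); apply: lerD; first exact: driftA.
by rewrite (bigD1 (w p))//= lerDl sumr_ge0.
Qed.

Let gI0 t k w : t <= T -> mu.-integrable `]0, t] (EFin \o (fun r => g k (r, w))).
Proof.
move=> tT; apply: integrableS (gI k w).
- exact: measurable_itv.
- exact: measurable_itv.
- by apply: subset_itvl; rewrite bnd_simp.
Qed.

Let lebesgue_itv_lty t : (mu `]0%R, t] < +oo)%E.
Proof.
by rewrite lebesgue_measure_itv/=; case: ifP => _; rewrite ?ltry// -EFinB ltry.
Qed.

Let cstI t (a : R) : mu.-integrable `]0, t] (EFin \o cst a).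
Proof.
apply: (@measurable_bounded_integrable _ _ _ mu _ _ (measurable_itv `]0, t])).
- exact: lebesgue_itv_lty.
- exact: measurable_cst.
- exact: bounded_cst.
Qed.

Let DomE t w : t <= T -> mu.-integrable `]0, t] (EFin \o Dom w) /\
  \int[mu]_(r in `]0, t]) Dom w r =
  \int[mu]_(r in `]0, t]) A + \sum_k \int[mu]_(r in `]0, t]) `|g k (r, w)|.
Proof.
move=> tT; have nI k := integrable_norm (gI0 k w tT).
have mI : measurable [set` `]0, t]] by exact: measurable_itv.
have sI : mu.-integrable `]0, t] (EFin \o (fun r => \sum_k `|g k (r, w)|)).
  have := @integrable_sum _ _ _ mu _ mI 'I_m.+1 (index_enum _) xpredT
    (fun k => EFin \o (Num.norm \o (fun r => g k (r, w)))) (fun k _ => nI k).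
  by apply: eq_integrable => // r _; rewrite /= -sumEFin.
split; first exact: (@integrableD _ _ _ mu _ mI _ _ (cstI t A) sI).
rewrite (@RintegralD _ _ _ mu _ _ _ mI (cstI t A) sI); congr (_ + _).
exact: (@Rintegral_sum _ _ _ mu _ mI _ _ (fun k => Num.norm \o (fun r => g k (r, w)))).
Qed.

(** The right-hand side is free of w: it dominates the Riemann sums over paths and makes [Psi]
    integrable for the product measure. *)
Let Dom_le t w : 0 < t <= T -> \int[mu]_(r in `]0, t]) Dom w r <= A * T + m.+1%:R * C.
Proof.
move=> /andP[t0 tT]; have [_ ->] := DomE w tT.
rewrite Rintegral_cst; last exact: measurable_itv.
have A0 : 0 <= A by exact: le_trans (normr_ge0 _) (driftA 0 point).
apply: lerD.
  rewrite [fine _](_ : _ = t) ?ler_wpM2l//.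
  by rewrite [X in fine X]lebesgue_measure_itv/= lte_fin t0/= subr0.
rewrite mulr_natl -[X in _ <= _ *+ X](card_ord m.+1) -sumr_const; apply: ler_sum => k _.
rewrite /Rintegral -lee_fin fineK; last first.
  apply: (@integrable_fin_num _ _ _ mu _ (measurable_itv `]0, t])).
  exact: (integrable_norm (gI0 k w tT)).
apply: le_trans (gC k w); apply: ge0_subset_integral => //.
- apply/measurable_EFinP/measurable_funTS.
  exact: (measurableT_comp (@normr_measurable R setT) (mgw k w)).
- by apply: subset_itvl; rewrite bnd_simp.
Qed.

Let Z t (w : path) : R := \int[mu]_(r in `]0, t]) Psi (r, w).
Let Zn t n (w : path) : R :=
  \sum_(c < n.+1) \int[mu]_(r in mesh_cell t n c) Phi w (mesh_pt t n c.+1) r.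

Let path_riemann t w : 0 < t <= T ->
  [/\ mu.-integrable `]0, t] (EFin \o (fun r => Psi (r, w))),
    Zn t n w @[n --> \oo] --> Z t w &
    forall n, `|Zn t n w| <= A * T + m.+1%:R * C].
Proof.
move=> tT; have /andP[t0 tT'] := tT.
have [||||H1 H2 H3] := @right_riemann_cvg R t t0 (Phi w) (Dom w).
- by move=> p; apply: measurable_funD; [exact: measurable_cst|exact: mgw].
- by have [] := DomE w tT'.
- exact: PhiD.
- move=> r _; have e : \forall p \near r^'+,
      (\sum_j G (w r) j * f j p w) + g (w r) (r, w) = Phi w p r.
    by apply: filterS (path_right_cst w r) => p wp; rewrite /Phi /drift wp.
  apply: cvg_trans (near_eq_cvg e) _; rewrite /Phi /drift.
  apply: cvgD; last exact: cvg_cst.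
  apply: cvg_big => [|j _]; first exact: add_continuous.
  apply: cvgM; first exact: cvg_cst.
  by apply: cvg_at_right_filter; exact: fcont.
split=> // n; exact: le_trans (H3 n) (Dom_le w tT).
Qed.

Let mfw p q : measurable_fun setT (fun w : path => f (w p) q w).
Proof. by apply: (@mat_state p (fun k w => f k q w)). Qed.

Lemma integrable_state p q : Pi.-integrable setT (EFin \o (fun w : path => f (w p) q w)).
Proof. by apply: (@bounded_integrable _ _ _ _ _ K). Qed.

Let driftI p : Pi.-integrable setT (EFin \o drift p).
Proof. by apply: (@bounded_integrable _ _ _ _ _ A). Qed.

Let cell_integral t n c w : 0 < t <= T -> (c < n.+1)%N ->
  \int[mu]_(r in mesh_cell t n c) Phi w (mesh_pt t n c.+1) r =
  t / n.+1%:R * drift (mesh_pt t n c.+1) w +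
  (f (w (mesh_pt t n c.+1)) (mesh_pt t n c.+1) w -
   f (w (mesh_pt t n c.+1)) (mesh_pt t n c) w).
Proof.
move=> /andP[t0 tT] cn; set y := mesh_pt t n c.+1; set x := mesh_pt t n c.
have h0 : 0 < t / n.+1%:R by rewrite divr_gt0.
have yE : y = x + t / n.+1%:R by exact: mesh_ptS.
have mI : measurable [set` `]x, y]] by exact: measurable_itv.
have sub : `]x, y]%classic `<=` `]0, t]%classic := mesh_cell_sub t0 cn.
have x0 : 0 <= x by rewrite /x -(mesh_pt0 t n) le_mesh_pt.
have yT : y <= T.
  by apply: le_trans tT; rewrite -[leRHS](mesh_pt_last t n) le_mesh_pt.
have cI : mu.-integrable `]x, y] (EFin \o cst (drift y w)).
  by apply: integrableS (cstI t _); [exact: measurable_itv|exact: mI|exact: sub].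
have gxy : mu.-integrable `]x, y] (EFin \o (fun r => g (w y) (r, w))).
  by apply: integrableS (gI0 _ w tT); [exact: measurable_itv|exact: mI|exact: sub].
rewrite (@RintegralD _ _ _ mu _ _ _ mI cI gxy); congr (_ + _).
  rewrite Rintegral_cst// mulrC [fine _](_ : _ = t / n.+1%:R)//.
  rewrite [X in fine X]lebesgue_measure_itv/= lte_fin yE ltrDl h0 -EFinB/=.
  by rewrite addrC addKr.
by rewrite gE// yE lerDl ltW.
Qed.

Let ZnE t n : 0 < t <= T -> Zn t n = fun w : path => \sum_(c < n.+1)
  (t / n.+1%:R * drift (mesh_pt t n c.+1) w +
   (f (w (mesh_pt t n c.+1)) (mesh_pt t n c.+1) w -
    f (w (mesh_pt t n c.+1)) (mesh_pt t n c) w)).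
Proof.
by move=> tT; apply/funext => w; apply: eq_bigr => c _; exact: cell_integral.
Qed.

Let mZn t n : 0 < t <= T -> measurable_fun setT (Zn t n).
Proof.
move=> tT; rewrite ZnE//; apply: measurable_sum => c; apply: measurable_funD.
  by apply: measurable_funM => //; exact: measurable_cst.
exact: measurable_funB.
Qed.

Let Zcvg t : 0 < t <= T -> Pi.-integrable setT (EFin \o Z t) /\
  \int[Pi]_w Zn t n w @[n --> \oo] --> \int[Pi]_w Z t w.
Proof.
move=> tT; apply: (@Rintegral_dominated_cvg _ _ _ Pi _ measurableT (Zn t) (Z t)
  (cst (A * T + m.+1%:R * C))).
- by move=> n; exact: mZn.
- by move=> w _; have [] := path_riemann w tT.
- exact: finite_measure_integrable_cst.
- by move=> n w _; have [_ _] := path_riemann w tT; exact.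
Qed.

Let EZn t n : 0 < t <= T -> \int[Pi]_w Zn t n w = \sum_(c < n.+1)
  (t / n.+1%:R * theta (mesh_pt t n c.+1) + (F (mesh_pt t n c.+1) -
    \int[Pi]_w f (w (mesh_pt t n c.+1)) (mesh_pt t n c) w)).
Proof.
move=> tT; rewrite ZnE//.
have hI c : Pi.-integrable setT (EFin \o
    (fun w => t / n.+1%:R * drift (mesh_pt t n c.+1) w)).
  exact: (integrableZl measurableT (t / n.+1%:R) (driftI (mesh_pt t n c.+1))).
have BI c : Pi.-integrable setT (EFin \o (fun w : path =>
   f (w (mesh_pt t n c.+1)) (mesh_pt t n c.+1) w -
   f (w (mesh_pt t n c.+1)) (mesh_pt t n c) w)).
  exact: (integrableB measurableT (integrable_state _ _) (integrable_state _ _)).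
rewrite Rintegral_sum//; last first.
  by move=> c; exact: (integrableD measurableT (hI c) (BI c)).
apply: eq_bigr => c _; rewrite (RintegralD measurableT (hI c) (BI c)).
rewrite (RintegralZl _ measurableT (driftI _)).
by rewrite (RintegralB measurableT (integrable_state _ _) (integrable_state _ _)).
Qed.

Let EZ t : 0 < t <= T -> \int[Pi]_w Z t w = F t - F 0.
Proof.
move=> tT; have /andP[t0 tT'] := tT; have [_ cvZ] := Zcvg tT.
have [CM CM0 HM] := markov_first_order P_markov P_start.
(* The first term comes from moving the drift from right to left end points, which telescopes; the
   second collects n+1 errors CM K h^2, that is CM K t h. *)
pose B := `|theta t - theta 0| + CM * K * t.
have B0 : 0 <= B by rewrite addr_ge0// !mulr_ge0// ltW.
have bound n : t / n.+1%:R <= 1 ->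
    `|F t - F 0 - \int[Pi]_w Zn t n w| <= t / n.+1%:R * B.
  set h := t / n.+1%:R => h1.
  have h0 : 0 < h by rewrite divr_gt0.
  have tele (H : R -> R) : H t - H 0 =
      \sum_(c < n.+1) (H (mesh_pt t n c.+1) - H (mesh_pt t n c)).
    rewrite -(big_mkord xpredT (fun c => H (mesh_pt t n c.+1) - H (mesh_pt t n c))).
    by rewrite (telescope_sumr (fun c => H (mesh_pt t n c)))// mesh_pt_last mesh_pt0.
  rewrite EZn// -/h.
  rewrite (_ : _ - _ = - (h * (theta t - theta 0)) + \sum_(c < n.+1)
    (\int[Pi]_w f (w (mesh_pt t n c.+1)) (mesh_pt t n c) w - F (mesh_pt t n c) -
     h * theta (mesh_pt t n c))); last first.
    rewrite (tele F) (tele theta) mulr_sumr -!sumrN -!big_split/=.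
    by apply: eq_bigr => c _; ring.
  rewrite /B [leRHS]mulrDr; apply: (le_trans (ler_normD _ _)); apply: lerD.
    by rewrite normrN normrM ger0_norm// ltW.
  apply: (le_trans (ler_norm_sum _ _ _)).
  apply: (@le_trans _ _ (\sum_(c < n.+1) CM * K * h ^+ 2)).
    apply: ler_sum => c _.
    have x0 : 0 <= mesh_pt t n c by rewrite -(mesh_pt0 t n) le_mesh_pt.
    have yx : mesh_pt t n c.+1 - mesh_pt t n c = h by rewrite mesh_ptS addrC addKr.
    have := HM (mesh_pt t n c) (mesh_pt t n c.+1) K x0 (fun j => f j (mesh_pt t n c)).
    rewrite yx; apply; [|by []|by []|by move=> j w; exact: fstop].
    by rewrite mesh_ptS ltrDl h0/= lerD2l.
  rewrite sumr_const card_ord -[leLHS]mulr_natl.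
  rewrite (_ : h * (CM * K * t) = n.+1%:R * (CM * K * h ^+ 2))//.
  have tn : t = n.+1%:R * h by rewrite /h mulrC divfK// pnatr_eq0.
  by rewrite [in LHS]tn; ring.
apply: (cvg_unique _ cvZ) => //; apply/cvgrPdist_le => e e0.
(* The first bound makes the step at most 1, as the first-order estimate demands; the second makes
   the step times B at most e. *)
exists (maxn (Num.bound t) (Num.bound (t * B / e))) => // n /= nN.
have nt : t <= n.+1%:R.
  apply: (le_trans (ltW (archi_boundP (ltW t0)))); rewrite ler_nat.
  by rewrite (leq_trans _ (leqW nN))// leq_maxl.
have ntB : t * B <= n.+1%:R * e.
  rewrite -ler_pdivrMr//; apply: (le_trans (ltW (archi_boundP _))).
    by rewrite divr_ge0// ?(ltW e0)// mulr_ge0// ltW.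
  by rewrite ler_nat (leq_trans _ (leqW nN))// leq_maxr.
apply: (le_trans (bound n _)); first by rewrite ler_pdivrMr// mul1r.
by rewrite mulrAC ler_pdivrMr// mulrC [e * _]mulrC mulrC.
Qed.

Let H t (x : R * path) : R := \1_[set` `]0, t]] x.1 * Psi x.

Let mH t : measurable_fun setT (H t).
Proof.
apply: measurable_funM => //; apply: measurableT_comp; last exact: measurable_fst.
by apply: measurable_indic; exact: measurable_itv.
Qed.

Let HI t : 0 < t <= T -> (mu \x Pi)%E.-integrable setT (EFin \o H t).
Proof.
move=> tT; have mEH : measurable_fun setT (EFin \o H t) by exact/measurable_EFinP.
apply/(integrable21ltyP mu Pi mEH).
pose c := A * T + m.+1%:R * C.
apply: (@le_lt_trans _ _ (\int[Pi]_w (cst c%:E) w)%E); last first.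
  rewrite integral_cst// [X in (_ * X)%E](_ : _ = 1%E) ?mule1 ?ltry//.
  exact: probability_setT.
apply: ge0_le_integral => //.
- by move=> w _; apply: integral_ge0 => r _; exact: abse_ge0.
- have mabs : measurable_fun setT (abse \o (EFin \o H t)) by exact: measurableT_comp.
  exact: (@measurable_fun_fubini_tonelli_G _ _ _ _ _ mu _ mabs (fun x => abse_ge0 _)).
- move=> w _.
  have [_ tT'] := andP tT; have [DI _] := DomE w tT'.
  have := Dom_le w tT; rewrite -lee_fin /Rintegral fineK; last first.
    exact: (@integrable_fin_num _ _ _ mu _ (measurable_itv `]0, t])).
  apply: le_trans.
  rewrite (_ : (fun r => _) = (fun r => `|Psi (r, w)|%:E) \_ [set` `]0, t]]); last first.
    apply/funext => r /=; rewrite /H patchE indicE.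
    by case: (_ \in _); rewrite ?mul1r ?mul0r ?normr0.
  rewrite -integral_mkcond; apply: ge0_le_integral => //.
  - apply/measurable_EFinP/measurable_funTS.
    exact: (measurableT_comp (@normr_measurable R setT)
      (measurableT_comp mPsi (pair2_measurable w))).
  - by have /integrableP[] := DI.
  - by move=> r _; rewrite lee_fin; exact: PhiD.
Qed.

(** Fubini's theorem speaks of this extended-valued function, differentiation of the real-valued
    [rho] below; they agree where [I0] is finite, hence almost everywhere. Both use [H T], so that
    one density serves all t in ]0, T]. *)
Let I0 (r : R) : \bar R := (\int[Pi]_w (H T (r, w))%:E)%E.
Let rho (r : R) : R := \int[Pi]_w H T (r, w).

Let TT : 0 < T <= T. Proof. by rewrite T0/=. Qed.

Let I0_int : mu.-integrable setT I0.
Proof. exact: (integrable_fubini_F (HI TT)). Qed.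

Let rho_int : mu.-integrable setT (EFin \o rho).
Proof.
apply: (@le_integrable _ _ _ mu setT measurableT _ I0).
- have /integrableP[mI0 _] := I0_int.
  apply/measurable_EFinP.
  exact: (measurableT_comp (@fine_measurable R setT measurableT) mI0).
- move=> r _; change (`|(fine (I0 r))%:E| <= `|I0 r|)%E.
  by case: (I0 r) => [x||] /=; rewrite ?normr0 ?leey.
- exact: I0_int.
Qed.

Let F_rho t : 0 < t <= T -> \int[mu]_(r in `]0, t]) rho r = F t - F 0.
Proof.
move=> tT; have /andP[t0 tT'] := tT.
have := Fubini (HI tT); rewrite /=.
rewrite [X in _ = X -> _](_ : _ = (F t - F 0)%:E); last first.
  have [ZI _] := Zcvg tT.
  rewrite -EZ// /Rintegral fineK ?integrable_fin_num//; apply: eq_integral => w _ /=.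
  have [PI _ _] := path_riemann w tT.
  rewrite /Z /Rintegral fineK; last first.
    exact: (@integrable_fin_num _ _ _ mu _ (measurable_itv `]0, t])).
  rewrite [RHS]integral_mkcond; apply: eq_integral => r _.
  by rewrite /H patchE indicE; case: (_ \in _); rewrite ?mul1r ?mul0r.
rewrite [X in X = _ -> _](_ : _ = (\int[mu]_(r in `]0%R, t]) I0 r)%E); last first.
  rewrite [RHS]integral_mkcond; apply: eq_integral => r _; rewrite patchE.
  case: ifPn => rt; last first.
    rewrite (eq_integral (cst 0%E)) ?integral0// => w _.
    by rewrite /H indicE (negbTE rt) mul0r.
  apply: eq_integral => w _; rewrite /H !indicE rt mem_set//=.
  move: rt; rewrite inE /= !in_itv/= => /andP[-> rt].
  exact: le_trans rt tT'.
move=> IE; rewrite /Rintegral; have -> : F t - F 0 = fine (F t - F 0)%:E by [].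
rewrite -IE; congr fine; have /integrableP[mI0 _] := I0_int.
have /integrableP[mrho _] := rho_int.
apply: ae_eq_integral.
- exact: measurable_itv.
- exact: measurable_funTS mrho.
- exact: measurable_funTS mI0.
- have := integrable_ae measurableT I0_int; move=> /ae_imply; apply => r /(_ I) fr _.
  by rewrite /rho /Rintegral -/(I0 r) fineK.
Qed.

(** Differentiability is claimed for all k at once, which covers the random state w(s). *)
Lemma derive_expectation_at_state : {ae mu, forall s, 0 < s < T ->
  [/\ {ae Pi, forall w, forall k, derivable (f k ^~ w) s 1},
      Pi.-integrable setT (EFin \o (fun w : path =>
        \sum_j G (w s) j * f j s w + derive1 (f (w s) ^~ w) s)),
      derivable F s 1 &
      derive1 F s = \int[Pi]_w
        (\sum_j G ((w : path) s) j * f j s w + derive1 (f (w s) ^~ w) s)]}.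
Proof.
have ae1 : {ae mu, forall s, 0 < s -> {ae Pi, forall w, forall k, derivable (f k ^~ w) s 1}}.
  (* Only positive times are kept, since [gD] gives differentiability almost everywhere there. *)
  pose N k := [set x : R * path | 0 < x.1] `&`
    ~` [set x : R * path | derivable (f k ^~ x.2) x.1 1].
  have mN k : measurable (N k).
    apply: measurableI; last first.
      by apply: measurableC; exact: (measurable_derivable (mf k) (@fcont k)).
    rewrite (_ : [set x : R * path | 0 < x.1] = setT `&` fst @^-1` `]0, +oo[%classic).
      by apply: measurable_fst => //; exact: measurable_itv.
    by rewrite setTI; apply/seteqP; split => x; rewrite /= in_itv/= andbT.
  have N0 k : {ae mu, forall s, Pi (xsection (N k) s) = 0%E}.
    apply: (@ae_null_xsection _ _ _ _ _ mu Pi (N k) (mN k)) => w.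
    have [M [mM M0 NM]] := gD k w.
    have mY := measurable_ysection w (mN k).
    apply: (@subset_measure0 _ _ _ mu _ M mY mM _ M0).
    by move=> r; rewrite /ysection /= inE => -[/= r0 nd]; apply: NM => /= /(_ r0).
  have : {ae mu, forall s, forall k, Pi (xsection (N k) s) = 0%E}.
    by apply: (@filter_forall _ _ _ _ (ae_filter_ringOfSetsType mu)).
  move=> /ae_imply; apply => s Ns s0.
  apply: (@filter_forall _ _ _ _ (ae_filter_ringOfSetsType Pi)) => k.
  exists (xsection (N k) s); split; [exact: measurable_xsection|exact: Ns|].
  by move=> w nd; rewrite /xsection /= inE.
have ae2 := ae_integrable1 (HI TT).
have rho_loc := open_integrable_locally openT rho_int.
have rho_int0 y : mu.-integrable [set` Interval (BRight 0) (BRight y)] (EFin \o rho).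
  apply: integrableS rho_int => //; exact: measurable_itv.
have ae3 := FTC1 rho_int0 rho_loc.
apply: (ae_imply (ae_and ae1 (ae_and ae2 ae3))) => s [H1 [H2 H3]] /andP[s0 sT].
have HTE w : H T (s, w) = Psi (s, w).
  by rewrite /H indicE mem_set ?mul1r//= in_itv/= s0 ltW.
have rhoE : rho s = \int[Pi]_w Psi (s, w) by apply: eq_Rintegral => w _; rewrite HTE.
have [dF F'] := H3 s0.
pose I1 (y : R) : R := \int[mu]_(r in `]0, y]) rho r.
have near_F : \forall y \near s, (I1 \+ cst (F 0)) y = F y.
  near=> y; rewrite /I1 /= F_rho; first by rewrite subrK.
  apply/andP; split; first by near: y; exact: lt_nbhsr.
  by apply: ltW; near: y; exact: lt_nbhsl.
have dI1 : is_derive s 1 I1 (rho s).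
  by move: F'; rewrite derive1E => F'; exact: (DeriveDef dF F').
have dI1F : is_derive s 1 (I1 \+ cst (F 0)) (rho s).
  by rewrite -[rho s]addr0; apply: is_deriveD.
have dFs := near_eq_is_derive near_F dI1F.
split.
- exact: H1.
- by move: H2; apply: eq_integrable => // w _; rewrite /= HTE.
- exact: ex_derive.
- by rewrite derive1E derive_val rhoE.
Unshelve. all: by end_near. Qed.

End expectation_derivative.

(** * Admissible curves *)

Section curves.
Context {R : realType} {m N : nat}.
Local Notation path := (skorokhod R m).
Variable gamma : path -> R -> 'rV[R]_N.+1.

(** The definition asks for nonempty disjoint open intervals inside [0, T]: a chain is clamped, and
    its degenerate intervals, which contribute nothing to either sum, are discarded. *)
Lemma uniformly_locally_AC_chain (T e : R) : uniformly_locally_AC gamma ->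
  0 <= T -> 0 < e -> exists2 d : R, 0 < d & forall w lo s, chain lo s -> mesh s < d ->
    \sum_(p <- s) `|gamma w (clamp T p.2) - gamma w (clamp T p.1)| <= e.
Proof.
move=> gAC T0 e0; have [||| d d0 hd] := gAC `[0, T]%classic _ _ _ e e0.
- by move=> x; rewrite /Rplus /= !in_itv/= => /andP[->].
- exact: interval_is_interval.
- exact: compact_bounded (@segment_compact _ _ _).
exists d => // w lo s cs ms.
pose s' := [seq p <- map (clamp_pair T) s | p.1 < p.2].
have [/allP ca cp] := chain_pairwise (chain_clamp T cs).
have cp' : pairwise (fun p q : R * R => p.2 <= q.1) s' by exact: pairwise_filter.
pose a (j : 'I_(size s')) := (nth (0, 0) s' j).1.
pose b (j : 'I_(size s')) := (nth (0, 0) s' j).2.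
have s'P (j : 'I_(size s')) : [/\ 0 <= a j, a j < b j & b j <= T].
  have : nth (0, 0) s' j \in s' by exact: mem_nth.
  rewrite mem_filter /a /b => /andP[lt_ab /mapP[p _ ep]].
  by split => //; rewrite ep/= ?clamp_ge0 ?clamp_le.
have abt (j k : 'I_(size s')) : (j < k)%N -> b j <= a k.
  by move=> jk; move/(pairwiseP (0, 0)): cp' => /(_ j k); apply => //; rewrite inE.
have sumE (H : R * R -> R) : (forall x, H (x, x) = 0) ->
    \sum_(p <- s) H (clamp_pair T p) = \sum_(j < size s') H (a j, b j).
  move=> H0; rewrite -(big_map (clamp_pair T) predT) (bigID (fun p => p.1 < p.2))/=.
  rewrite [X in _ + X]big_seq_cond [X in _ + X]big1 ?addr0.
    rewrite -big_filter -/s' (big_nth (0, 0)) big_mkord.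
    by apply: eq_bigr => j _; rewrite -surjective_pairing.
  move=> [x y] /andP[/ca/= /andP[_ xy]]; rewrite -leNgt => yx.
  by rewrite (@le_anti _ _ x y) ?xy.
rewrite [leLHS](sumE (fun p => `|gamma w p.2 - gamma w p.1|)); last first.
  by move=> x; rewrite subrr normr0.
apply/ltW/(hd _ a b) => [j|j x||].
- by have [] := s'P j.
- have [a0 _ bT] := s'P j; rewrite /= !in_itv/= => /andP[ax xb].
  by rewrite (le_trans a0 (ltW ax)) (le_trans (ltW xb) bT).
- move=> j k _ _ [x []]; rewrite /= !in_itv/= => /andP[ajx xbj] /andP[akx xbk].
  apply/val_inj; case: (ltngtP j k) => // [/abt bjak|/abt bkaj].
    by have := lt_trans xbj (le_lt_trans bjak akx); rewrite ltxx.
  by have := lt_trans xbk (le_lt_trans bkaj ajx); rewrite ltxx.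
rewrite -(sumE (fun p => p.2 - p.1)) => [|x]; last exact: subrr.
apply: le_lt_trans ms; apply: le_trans (mesh_clamp T0 cs).
by rewrite /mesh big_map.
Qed.

(** By nonanticipation at time 0, gamma(0, w) depends on w(0) only, so it takes finitely many
    values, those at constant paths. From there each time step of length d/2 adds at most 1 to the
    norm, for every w. *)
Lemma admissible_bounded (T : R) : uniformly_locally_AC gamma ->
  nonanticipating gamma -> 0 <= T ->
  exists M : R, forall w t, 0 <= t <= T -> `|gamma w t| <= M.
Proof.
move=> gAC gna T0; have [d d0 hd] := uniformly_locally_AC_chain gAC T0 ltr01.
pose M0 : R := \sum_k `|gamma (Path (cadlag_cst k)) 0|.
pose n := Num.bound (T / (d / 2)).
have d20 : 0 < d / 2 by rewrite divr_gt0.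
exists (n%:R + M0) => w t /andP[t0 tT].
have g0 : `|gamma w 0| <= M0.
  rewrite (gna 0 (lexx _) w (Path (cadlag_cst (w 0)))).
  - by rewrite /M0 (bigD1 (w 0))//= lerDl sumr_ge0.
  - by move=> x; rewrite in_itv/= => x0; congr (w _); apply/esym/le_anti.
  - by rewrite in_itv/= lexx.
suff {t0 tT} : forall n t, 0 <= t <= T -> t <= n%:R * (d / 2) ->
    `|gamma w t| <= n%:R + M0.
  apply; first by rewrite t0.
  rewrite -ler_pdivrMr//; apply: (le_trans (y := T / (d / 2))).
    by rewrite ler_pM2r ?invr_gt0.
  by apply/ltW/archi_boundP; rewrite divr_ge0// ltW.
elim=> [|k ih] {}t /andP[t0 tT] tk.
  by rewrite (_ : t = 0) ?add0r//; apply/le_anti; rewrite t0 (le_trans tk)// mul0r.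
pose t' := Num.max 0 (t - d / 2).
have t't : 0 <= t' <= t by rewrite /t' le_max lexx ge_max t0/= gerBl ltW.
have t't' : t - t' < d.
  rewrite ltrBlDl -ltrBlDr lt_max; apply/orP; right.
  by rewrite ltrD2l ltrN2 ltr_pdivrMr// ltr_pMr// ltr1n.
have t'k : `|gamma w t'| <= k%:R + M0.
  apply: ih; first by case/andP: t't => -> /= /le_trans ->.
  rewrite ge_max (mulr_ge0 (ler0n _ _) (ltW d20))/= lerBlDr.
  by rewrite (le_trans tk)// -natr1 mulrDl mul1r.
have := hd w t' [:: (t', t)]; rewrite /= lexx; case/andP: (t't) => t'0 -> /(_ isT).
rewrite /mesh !big_seq1/= => /(_ t't'); rewrite !clamp_id ?t0 ?t'0// ?(le_trans _ tT)//; last first.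
  by case/andP: t't.
move=> dist; rewrite -[gamma w t](subrK (gamma w t')) (le_trans (ler_normD _ _))//.
by rewrite -natr1 -addrA [_%:R + _]addrC -addrA lerD// addrC.
Qed.

(** Uniform convergence on the compact set {t} makes evaluation at t continuous, so preimages of
    open rays are open in the space of curves. *)
Lemma measurable_curve_at (t : R) (phi : 'rV[R]_N.+1 -> R) : random_curve gamma ->
  0 <= t -> continuous phi -> measurable_fun setT (fun w => phi (gamma w t)).
Proof.
move=> [_ gm] t0 cphi.
have ev : continuous
    (fun h : {family compactly_in (Rplus R), R -> 'rV[R]_N.+1} => phi (h t)).
  move=> h; apply: continuous_comp; last exact: cphi.
  have /fam_cvgP := @cvg_id _ (nbhs (h : {family compactly_in (Rplus R), R -> 'rV[R]_N.+1})).
  move=> /(_ [set t]); rewrite uniform_set1; apply.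
  by split; [move=> _ ->; rewrite /Rplus /= in_itv/= t0 | exact: compact_set1].
apply: (measurability _ (RGenOInfty.measurableE R)) => // _ [_ [c ->] <-].
rewrite setTI; apply: (gm [set h | `]c, +oo[%classic (phi (h t))]).
by apply: open_comp => [h _|]; [exact: ev | exact: interval_open].
Qed.

End curves.

Lemma cV_entry_le_norm (R : realType) n (v : 'cV[R]_n.+1) k : `|v k 0| <= `|v|.
Proof.
rewrite [leRHS]/Num.norm /= mx_normrE.
exact: (le_bigmax _ (fun ij => `|v ij.1 ij.2|) (k, 0)).
Qed.

(** * Composition of u with an admissible curve *)

Section composition.
Context {R : realType} {m N : nat}.
Variable u : R * 'rV[R]_N.+1 -> 'cV[R]_m.+1.
Hypothesis u_lip : [locally [lipschitz u x | x in Rplus R `*` [set: 'rV[R]_N.+1]]].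

Lemma cylinder_lipschitz (T M : R) : exists2 L : R, 0 <= L &
  forall k a b x y, 0 <= a <= T -> 0 <= b <= T -> `|x| <= M -> `|y| <= M ->
    `|u (a, x) k 0 - u (b, y) k 0| <= L * (`|a - b| + `|x - y|).
Proof.
pose ballM := [set x : 'rV[R]_N.+1 | `|x| <= M].
have cball : compact ballM.
  apply: bounded_closed_compact.
    by exists M; split; [exact: num_real | move=> y My x /= /le_trans; apply; exact: ltW].
  apply: (@preimage_closed _ _ (fun x : 'rV[R]_N.+1 => `|x|) [set y : R | y <= M]).
    by move=> x _; exact: norm_continuous.
  exact: closed_le.
have [L L0 uL] : exists2 L : R, 0 <= L & forall x y, (`[0, T] `*` ballM) x ->
    (`[0, T] `*` ballM) y -> `|u x - u y| <= L * `|x - y|.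
  apply: (locally_lipschitz_compact u_lip); last exact: compact_setX (@segment_compact _ _ _) cball.
  by move=> [a x] [/= aT _]; split => //; move: aT; rewrite /Rplus /= !in_itv/= => /andP[->].
exists L => // k a b x y aT bT xM yM.
have := uL (a, x) (b, y); move=> /(_ (conj _ xM) (conj _ yM)); rewrite /= !in_itv/=.
move=> /(_ aT bT) uxy.
have := cV_entry_le_norm (u (a, x) - u (b, y)) k; rewrite !mxE => /le_trans; apply.
apply: (le_trans uxy); rewrite ler_wpM2l// prod_normE/= ge_max.
by rewrite lerDl lerDr !normr_ge0.
Qed.

Lemma slice_continuous t k : 0 <= t -> continuous (fun x => u (t, x) k 0).
Proof.
move=> t0 x; have [L L0 uL] := cylinder_lipschitz t (`|x| + 1).
have tt : 0 <= t <= t by rewrite t0 lexx.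
apply/(@cvgrPdist_le _ _ _ _ (nbhs_filter x)) => e e0; have L1 : 0 < L + 1 by rewrite ltr_wpDl.
have d0 : 0 < Num.min 1 (e / (L + 1)) by rewrite lt_min ltr01 divr_gt0.
apply: filterS (nbhsx_ballx x _ d0) => y; rewrite -ball_normE /= lt_min.
move=> /andP[/ltW xy1 /ltW xy]; have yM : `|y| <= `|x| + 1.
  by rewrite -[y](subKr x) (le_trans (ler_normB _ _))// lerD2l.
apply: (le_trans (uL k t t x y tt tt _ yM)); first by rewrite lerDl.
rewrite subrr normr0 add0r (le_trans (y := (L + 1) * `|x - y|))//.
  by rewrite ler_wpM2r// lerDl.
by rewrite mulrC -ler_pdivlMr.
Qed.

Local Notation path := (skorokhod R m).
Variable gamma : path -> R -> 'rV[R]_N.+1.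
Hypothesis gamma_adm : admissible gamma.

Variable T : R.
Hypothesis T0 : 0 < T.

(** This is the f_k(t, w) of the overview. *)
Definition stopped_value (k : 'I_m.+1) (t : R) (w : path) : R :=
  u (clamp T t, gamma w (clamp T t)) k 0.

Let clampT t : 0 <= clamp T t <= T.
Proof. by rewrite clamp_ge0 clamp_le// ltW. Qed.

Lemma measurable_stopped_value k t : measurable_fun setT (stopped_value k t).
Proof.
have [rc _ _] := gamma_adm.
exact: measurable_curve_at rc (clamp_ge0 _ _) (slice_continuous (clamp_ge0 _ _)).
Qed.

Lemma stopped_value_clamp k t w : stopped_value k t w = stopped_value k (clamp T t) w.
Proof. by rewrite /stopped_value (@clamp_id _ T (clamp T t)). Qed.

(** Nonanticipation of gamma, in the form used by the Markov estimates; the clamped time never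
    exceeds a. *)
Lemma stopped_value_stop k a (a0 : 0 <= a) w :
  stopped_value k a (stop a0 w) = stopped_value k a w.
Proof.
have [_ _ gna] := gamma_adm; rewrite /stopped_value.
rewrite (gna a a0 _ w)//; first exact: stop_eq.
by rewrite in_itv/= clamp_ge0/= /clamp ge_max a0 ge_min lexx.
Qed.

Lemma stopped_value_lipschitz : exists2 L : R, 0 <= L & forall k w a b,
  `|stopped_value k b w - stopped_value k a w| <=
  L * (`|clamp T b - clamp T a| + `|gamma w (clamp T b) - gamma w (clamp T a)|).
Proof.
have [_ gAC gna] := gamma_adm.
have [M gM] := admissible_bounded gAC gna (ltW T0).
have [L L0 uL] := cylinder_lipschitz T M.
by exists L => // k w a b; apply: uL; rewrite ?gM.
Qed.

Lemma stopped_value_bounded : exists K : R, forall k t w, `|stopped_value k t w| <= K.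
Proof.
have [_ gAC gna] := gamma_adm.
have [M gM] := admissible_bounded gAC gna (ltW T0).
have [L L0 uL] := cylinder_lipschitz T M.
have M0 : 0 <= M by exact: le_trans (normr_ge0 _) (gM point _ (clampT 0)).
exists (L * (T + M) + `|u (0, 0)|) => k t w.
rewrite -[stopped_value k t w](subrK (u (0, 0) k 0)) (le_trans (ler_normD _ _))//.
apply: lerD; last exact: cV_entry_le_norm.
have T00 : 0 <= (0 : R) <= T by rewrite lexx ltW.
have := uL k _ _ _ _ (clampT t) T00 (gM w _ (clampT t)); move=> /(_ 0).
rewrite normr0 => /(_ M0) /le_trans; apply.
by rewrite !subr0 ler_wpM2l// lerD ?gM// ger0_norm ?clamp_ge0// clamp_le// ltW.
Qed.

Lemma stopped_value_AC (e : R) : 0 < e ->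
  exists2 d : R, 0 < d & forall k w, abs_cont_modulus (stopped_value k ^~ w) e d.
Proof.
move=> e0; have [_ gAC _] := gamma_adm.
have [L L0 uL] := stopped_value_lipschitz.
have L1 : 0 < L + 1 by rewrite ltr_wpDl.
have e' : 0 < e / (L + 1) / 2 by rewrite !divr_gt0.
have [d d0 hd] := uniformly_locally_AC_chain gAC (ltW T0) e'.
(* Half of e pays for the variation in time and half for that of the curve; L + 1 keeps the quotient
   meaningful when L = 0. *)
exists (Num.min d (e / (L + 1) / 2)); first by rewrite lt_min d0.
move=> k w lo s cs; rewrite lt_min => /andP[/(hd w _ _ cs) gs ms].
rewrite /jumps (le_trans (y := (L + 1) * (\sum_(p <- s) `|clamp T p.2 - clamp T p.1| +
    \sum_(p <- s) `|gamma w (clamp T p.2) - gamma w (clamp T p.1)|)))//.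
  rewrite -big_split mulr_sumr; apply: ler_sum => p _.
  by rewrite (le_trans (uL _ _ _ _))// ler_wpM2r ?addr_ge0// lerDl.
rewrite mulrC -ler_pdivlMr// [leRHS]splitr lerD// ltW//.
apply: le_lt_trans ms; apply: le_trans (mesh_clamp (ltW T0) cs).
rewrite /mesh big_map big_seq [leRHS]big_seq; apply: ler_sum => p ps /=.
have [/allP /(_ _ ps)/andP[_ p12] _] := chain_pairwise cs.
by rewrite ger0_norm// subr_ge0 le_clamp.
Qed.

End composition.

Theorem theorem4p7 (R : realType) (N m : nat) (B : 'M[R]_m.+1)
  (B_offdiag : forall i j : 'I_m.+1, j != i -> B i j <= 0)
  (B_rowsum : forall i, \sum_j B i j = 0)
  (P : probability (skorokhod R m) R)
  (P_markov : markov_chain (- B) P)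
  (P_start : forall i, (0 < P (start_at i))%E)
  (u : R * 'rV[R]_N.+1 -> 'cV[R]_m.+1)
  (u_lip : [locally [lipschitz u x | x in Rplus R `*` [set: 'rV[R]_N.+1]]])
  (gamma : skorokhod R m -> R -> 'rV[R]_N.+1)
  (gamma_adm : admissible gamma)
  (i : 'I_m.+1) :
  let Pi := start_law P i in
  let U t w := u (t, gamma w t) (w t) 0 in
  let V s w t := u (t, gamma w t) (w s) 0 in
  let rhs s w := - (B *m u (s, gamma w s)) (w s) 0 + derive1 (V s w) s in
  (* the expectation on the left-hand side is well defined *)
  (forall t, 0 <= t -> Pi.-integrable [set: skorokhod R m] (EFin \o U t)) /\
  {ae @lebesgue_measure R, forall s, 0 <= s ->
    [/\ (* the integrand on the right-hand side is defined almost surely *)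
        {ae Pi, forall w, derivable (V s w) s 1},
        Pi.-integrable [set: skorokhod R m] (EFin \o rhs s),
        derivable (fun t => fine 'E_Pi[U t]) s 1 &
        derive1 (fun t => fine 'E_Pi[U t]) s = fine 'E_Pi[rhs s]]}.
Proof.
move=> Pi U V rhs.
(* Lipschitz constants exist only on compact sets, so the result is proved for each horizon n+1 and
   the countably many null sets are joined at the end. *)
pose f n := stopped_value u gamma n.+1%:R.
have T0 n : 0 < n.+1%:R :> R by rewrite ltr0n.
have fV n (s t : R) (w : skorokhod R m) : 0 <= t <= n.+1%:R -> f n (w s) t w = V s w t.
  by move=> tn; rewrite /f /stopped_value /V clamp_id.
split=> [t t0|].
  have [K fK] := stopped_value_bounded u_lip gamma_adm (T0 (Num.bound t)).
  have mf := measurable_stopped_value u_lip gamma_adm (Num.bound t).+1%:R.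
  have := integrable_state P i mf fK t t.
  apply: eq_integrable => // w _ /=; rewrite -/(f _) fV//.
  rewrite t0 (le_trans (ltW (archi_boundP t0)))//.
  by rewrite ler_nat.
have core n : {ae @lebesgue_measure R, forall s, 0 < s < n.+1%:R ->
    [/\ {ae Pi, forall w, derivable (V s w) s 1},
        Pi.-integrable [set: skorokhod R m] (EFin \o rhs s),
        derivable (fun t => fine 'E_Pi[U t]) s 1 &
        derive1 (fun t => fine 'E_Pi[U t]) s = fine 'E_Pi[rhs s]]}.
  have [K fK] := stopped_value_bounded u_lip gamma_adm (T0 n).
  have := derive_expectation_at_state P_markov (P_start i) (T0 n)
    (measurable_stopped_value u_lip gamma_adm n.+1%:R)
    (stopped_value_AC u_lip gamma_adm (T0 n))
    (stopped_value_clamp u gamma (T0 n)) fK (@stopped_value_stop _ _ _ u gamma gamma_adm n.+1%:R).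
  move=> /ae_imply; apply => s Hs sn; have [H1 H2 H3 H4] := Hs sn.
  (* Derivatives at s are local, and near s the stopped functions coincide with the original
     ones. *)
  have s_near : \forall t \near s, 0 <= t <= n.+1%:R.
    by case/andP: sn => s0 sT; near=> t; apply/andP; split; apply/ltW; near: t;
      [exact: lt_nbhsr | exact: lt_nbhsl].
  have near_fV (w : skorokhod R m) : \forall t \near s, f n (w s) t w = V s w t.
    by apply: filterS s_near => t /fV.
  have near_EU : \forall t \near s, \int[Pi]_w f n ((w : skorokhod R m) t) t w = fine 'E_Pi[U t].
    apply: filterS s_near => t tn; rewrite expectation.unlock; congr fine.
    by apply: eq_integral => w _; rewrite fV.
  have rhsE (w : skorokhod R m) :
      \sum_j (- B) (w s) j * f n j s w + derive1 (f n (w s) ^~ w) s = rhs s w.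
    rewrite /rhs !derive1E (@near_eq_derive _ _ _ _ _ s 1 (near_fV w)); congr (_ + _).
    rewrite mxE -sumrN; apply: eq_bigr => j _; rewrite mxE mulNr.
    by rewrite /f /stopped_value clamp_id//; case/andP: sn => /ltW-> /ltW->.
  split.
  - by apply: (ae_imply H1) => w /(_ (w s)); exact: near_eq_derivable (near_fV w).
  - by apply: eq_integrable H2 => // w _ /=; rewrite rhsE.
  - exact: near_eq_derivable near_EU H3.
  - rewrite derive1E -(@near_eq_derive _ _ _ _ _ s 1 near_EU) -derive1E [LHS]H4.
    rewrite expectation.unlock; congr fine.
    by apply: eq_integral => w _; rewrite rhsE.
have := ae_foralln core.
(* The horizons cover only s > 0; the point 0 is thrown into the null set. *)
have : {ae @lebesgue_measure R, forall s : R, s != 0}.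
  exists [set 0]; split => //; first exact: lebesgue_measure_set1.
  by move=> s /= /negP; rewrite negbK => /eqP.
move=> /ae_and /[apply] /ae_imply; apply => s [s0 H] s_ge0.
apply: (H (Num.bound s)); rewrite lt_neqAle eq_sym s0 s_ge0/=.
by rewrite (lt_le_trans (archi_boundP s_ge0))// ler_nat.
Unshelve. all: by end_near. Qed.
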